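(* Let $A$ and $B$ be polynomially compact operators on a complex Hilbert space $\mathcal H$. Suppose that $B$ is normal and that $[A,B]B=0$. Then $A$ and $B$ are simultaneously triangularizable and $[A,B]^2=0$. If $A$ is also normal, then $A$ and $B$ are simultaneously diagonalizable, and so they commute.
   Context: Operators on $\mathcal H$ are bounded linear operators $\mathcal H\to\mathcal H$, and $[A,B]=AB-BA$. An operator $T$ is polynomially compact if there is a nonzero complex polynomial $p$ such that $p(T)$ is compact. $A$ and $B$ are simultaneously triangularizable if there is a chain (a set totally ordered by inclusion) of closed subspaces of $\mathcal H$, each invariant under both $A$ and $B$, which is maximal as a chain in the lattice of all closed subspaces of $\mathcal H$. An operator is diagonalizable if its eigenvectors span $\mathcal H$ (i.e. have closed linear span $\mathcal H$); $A$ and $B$ are simultaneously diagonalizable if their common eigenvectors span $\mathcal H$ in this sense. *)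

(* Defs.v *)
From HB Require Import structures.
From mathcomp Require Export all_boot all_order all_algebra.
From mathcomp Require Export complex.
From mathcomp Require Export boolp classical_sets reals topology normedtype.
Export numFieldNormedType.Exports.

Set Implicit Arguments.
Unset Strict Implicit.
Unset Printing Implicit Defensive.

Import Order.TTheory GRing.Theory Num.Theory.
Local Open Scope classical_set_scope.
Local Open Scope ring_scope.
Local Open Scope complex_scope.

Section Operators.
Variables (R : realType) (H : completeNormedModType R[i]).
Implicit Types (S T A B : H -> H) (V : set H) (x y : H).

Definition hilbert_inner_product (dot : {dot H for Num.conj}) : Prop :=
  forall x, `|x| ^+ 2 = dot x x.

Definition bounded_operator (T : {linear H -> H}) : Prop :=
  bounded_near T (nbhs (0 : H)).

(* The inner product is linear in its first argument. *)
Definition adjoint_of (dot : {dot H for Num.conj}) T S : Prop :=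
  forall x y, dot (T x) y = dot x (S y).

(* A bounded operator has exactly one bounded adjoint. *)
Definition normal_operator (dot : {dot H for Num.conj}) T : Prop :=
  exists S : {linear H -> H},
    [/\ bounded_operator S, adjoint_of dot T S & T \o S =1 S \o T].

Definition compact_operator T : Prop :=
  precompact (T @` [set x | `|x| <= 1]).

Definition poly_operator (p : {poly R[i]}) T : H -> H :=
  fun x => \sum_(k < size p) p`_k *: iter k T x.

Definition polynomially_compact T : Prop :=
  exists2 p : {poly R[i]}, p != 0 & compact_operator (poly_operator p T).

Definition commutator A B : H -> H := (A \o B) \- (B \o A).

Definition closed_subspace V : Prop :=
  [/\ closed V, V 0 & forall (a : R[i]) x y, V x -> V y -> V (a *: x + y)].

Definition invariant_under T V : Prop := forall x, V x -> V (T x).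

Definition subspace_chain (C : set (set H)) : Prop :=
  C `<=` closed_subspace /\ total_on C subset.

Definition maximal_subspace_chain (C : set (set H)) : Prop :=
  subspace_chain C /\ forall D, subspace_chain D -> C `<=` D -> D = C.

Definition simultaneously_triangularizable A B : Prop :=
  exists2 C : set (set H), maximal_subspace_chain C &
    forall V, C V -> invariant_under A V /\ invariant_under B V.

Definition eigenvector T x : Prop :=
  x != 0 /\ exists a : R[i], T x = a *: x.

Definition closed_span (X : set H) : set H := smallest closed_subspace X.

Definition simultaneously_diagonalizable A B : Prop :=
  closed_span [set x | eigenvector A x /\ eigenvector B x] = setT.

End Operators.

(* Main.v *)
Require Import Defs.
From mathcomp Require Import all_boot all_order all_algebra complex.
From mathcomp Require Import boolp classical_sets reals topology normedtype.
From mathcomp Require Import separable cyclic cyclotomic.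
From mathcomp Require Import zify ring lra.

(**
Let M be the closure of the range of B. As B is normal, M is the orthogonal
complement of the kernel of B, and it is also the closure of the range of B^2.
From AB^2 = BAB it follows that A maps the range of B^2 into the range of B, so
M is invariant under A, and that AB = BA on M. The commutator therefore
vanishes on M and takes all its values in M; its square is zero. This is
[range_closure_invariant_commute].

For triangularization, take by Zorn's lemma a chain C which is maximal among the
chains of common invariant closed subspaces comparable to M. If a closed
subspace V comparable to C did not belong to C, it would lie strictly inside a
gap (Vm, Vp) of C. On the gap, i.e. on Vp / Vm, the two operators commute: when
Vp is inside M because AB = BA there, and when M is inside Vm because B acts as
zero. Commuting polynomially compact operators have a common invariant subspace
as soon as there is room for one ([common_invariant_subspace]), so
the gap can be split ([common_invariant_gap]), against the maximality of C.

The invariant subspace theorem used here is Lomonosov's. If K = p(T) is compact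
with an eigenvector, then T has an eigenvector, and the eigenspace of T is
hyperinvariant. If K has no eigenvector it is quasinilpotent
([eigenvalue_free_quasinilpotent]), and Hilden's argument
([hyperinvariant_of_quasinilpotent_compact]) applies. Quasinilpotence is
obtained without any integration or Fredholm theory. Compactness bounds 1 - zK
below, uniformly on each disc. On a circle inside the disc where the powers
t^n K^n are under control, this bounds the partial sums of
sum (n+1) z^n K^n x = (1 - zK)^-2 x, and averaging over roots of unity turns the
bound into (n+1) t^n |K^n x| <= c |x| with c independent of t. The factor n+1
beats c for large n, so t can be increased by a fixed ratio, and this can be
repeated up to the radius of the disc.

If A is normal too, the key is that a normal polynomially compact operator T has
an eigenvector in every nonzero closed invariant subspace
([normal_invariant_eigenvector]): K = p(T) is normal, hence the norms |K^n x|
are log-convex in n, which excludes quasinilpotence. Let G be the orthogonal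
complement of the common eigenvectors, which is invariant under A and B. A
nonzero M /\ G would contain an eigenspace of B invariant under A, hence a
common eigenvector; and if M /\ G = 0 then B vanishes on G and any eigenvector
of A in G is a common one. So G = 0, and operators with a spanning set of common
eigenvectors commute.

Subspaces and quotients are not made into types. All statements are relative
to a closed subspace E of H, and the quotient of V by W is represented by
the intersection of V with the orthogonal complement of W.
*)

Set Implicit Arguments.
Unset Strict Implicit.
Unset Printing Implicit Defensive.
Import Order.TTheory GRing.Theory Num.Theory.
Local Open Scope classical_set_scope.
Local Open Scope ring_scope.
Local Open Scope complex_scope.

(** * Norms with real values *)

Section RealNorm.
Variables (R : realType).

(** The norm of a normed module over [R[i]] has values in [R[i]], which is
only partially ordered; estimates are carried out with its real part. *)
Definition rnorm (V : normedZmodType R[i]) (x : V) : R := complex.Re `|x|.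

Section NormedZmod.
Variable V : normedZmodType R[i].
Implicit Types x y : V.

Lemma rnormE x : `|x| = (rnorm x)%:C.
Proof. by rewrite /rnorm RRe_real// normr_real. Qed.

Lemma rnorm_ge0 x : 0 <= rnorm x.
Proof. by rewrite -ler0c -rnormE. Qed.

Lemma rnorm0 : rnorm (0 : V) = 0.
Proof. by rewrite /rnorm normr0. Qed.

Lemma rnorm_eq0 x : rnorm x = 0 -> x = 0.
Proof. by move=> x0; apply/eqP; rewrite -normr_eq0 rnormE x0. Qed.

Lemma rnorm_gt0 x : x != 0 -> 0 < rnorm x.
Proof.
move=> x0; rewrite lt_neqAle rnorm_ge0 andbT.
by apply: contra_neq x0 => /esym; exact: rnorm_eq0.
Qed.

Lemma rnormN x : rnorm (- x) = rnorm x.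
Proof. by rewrite /rnorm normrN. Qed.

Lemma rnormC x y : rnorm (x - y) = rnorm (y - x).
Proof. by rewrite -rnormN opprB. Qed.

Lemma rnormD x y : rnorm (x + y) <= rnorm x + rnorm y.
Proof. by rewrite -lecR rmorphD/= -!rnormE ler_normD. Qed.

Lemma rnormB x y z : rnorm (x - z) <= rnorm (x - y) + rnorm (y - z).
Proof. by rewrite (le_trans _ (rnormD _ _))// addrA subrK. Qed.

Lemma rnorm_sum n (f : 'I_n -> V) : rnorm (\sum_i f i) <= \sum_i rnorm (f i).
Proof.
elim/big_ind2 : _ => [|x a y b xa yb|//]; first by rewrite rnorm0.
by rewrite (le_trans (rnormD _ _))// lerD.
Qed.

(** The constant c lets the hypothesis be the raw outcome of an estimate,
without a rescaling of e. *)
Lemma eq0_of_rnorm_small x (c : R) :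
  (forall e, 0 < e -> rnorm x <= c * e) -> x = 0.
Proof.
move=> xe; apply: rnorm_eq0; apply/eqP; rewrite eq_le rnorm_ge0 andbT.
apply/ler_addgt0Pl => e e0; rewrite addr0.
have c0 : 0 < `|c| + 1 by rewrite ltr_pwDr.
rewrite (le_trans (xe (e / (`|c| + 1)) _)) ?divr_gt0// mulrA ler_pdivrMr//.
by rewrite mulrC ler_pM2l// (le_trans (ler_norm c))// lerDl.
Qed.

End NormedZmod.

Lemma rnormZ (V : normedModType R[i]) (a : R[i]) (x : V) :
  rnorm (a *: x) = rnorm a * rnorm x.
Proof. by apply: complexI; rewrite rmorphM/= -!rnormE normrZ. Qed.

Lemma rnormMn (V : normedModType R[i]) (x : V) n : rnorm (x *+ n) = n%:R * rnorm x.
Proof.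
by apply: complexI; rewrite rmorphM/= rmorph_nat -!rnormE normrMn mulr_natl.
Qed.

Lemma rnormM (a b : R[i]) : rnorm (a * b) = rnorm a * rnorm b.
Proof. by apply: complexI; rewrite rmorphM/= -!rnormE normrM. Qed.

Lemma rnormX (a : R[i]) n : rnorm (a ^+ n) = rnorm a ^+ n.
Proof. by apply: complexI; rewrite rmorphXn/= -!rnormE normrX. Qed.

Lemma rnorm_real (t : R) : 0 <= t -> rnorm (t%:C : R[i]) = t.
Proof. by move=> t0; rewrite /rnorm ger0_norm// lecR. Qed.

Lemma rnormV (a : R[i]) : rnorm a^-1 = (rnorm a)^-1.
Proof. by apply: complexI; rewrite fmorphV/= -!rnormE normfV. Qed.

End RealNorm.

(** * Closed subspaces and bounded linear maps *)

Section Metric.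
Variables (R : realType) (H : completeNormedModType R[i]).
Implicit Types (V W E : set H) (x y z : H) (T S K : H -> H).

Definition adherent V x := forall e : R, 0 < e -> exists2 y, V y & rnorm (x - y) < e.

Lemma rnorm_lt_ball x y (e : R) : ball x e%:C y <-> rnorm (x - y) < e.
Proof. by rewrite -ball_normE /ball_/= rnormE ltcR. Qed.

Lemma gt0_realC (e : R[i]) : 0 < e -> exists2 r : R, 0 < r & e = r%:C.
Proof.
case: e => a b; rewrite ltcE /= => /andP[/eqP -> a0].
by exists a.
Qed.

Lemma nbhs_rnorm x (A : set H) : nbhs x A <->
  exists2 e : R, 0 < e & forall y, rnorm (x - y) < e -> A y.
Proof.
split=> [/nbhs_ballP[e e0 eA]|[e e0 eA]].
  have [r r0 er] := gt0_realC e0; exists r => // y xy; apply: eA.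
  by rewrite er; apply/rnorm_lt_ball.
by apply/nbhs_ballP; exists e%:C; [rewrite /= ltcR|move=> y /rnorm_lt_ball; exact: eA].
Qed.

Lemma closed_adherent V : closed V <-> (forall x, adherent V x -> V x).
Proof.
split=> [cV x xV|cV x Vx].
  apply: cV => A /nbhs_rnorm[e e0 eA].
  by have [y Vy xy] := xV e e0; exists y; split=> //; exact: eA.
apply: cV => e e0.
have [|y [Vy /= xy]] := Vx [set y | rnorm (x - y) < e].
  by apply/nbhs_rnorm; exists e.
by exists y.
Qed.

Definition linear_subspace V := V 0 /\ forall (a : R[i]) x y, V x -> V y -> V (a *: x + y).

Lemma closed_subspace_adherentP V :
  closed_subspace V <-> linear_subspace V /\ (forall x, adherent V x -> V x).
Proof.
by split=> [[/closed_adherent ? ? ?]|[[? ?] /closed_adherent ?]]; split.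
Qed.

Lemma subspaceD V x y : linear_subspace V -> V x -> V y -> V (x + y).
Proof. by move=> [_ lV] Vx Vy; rewrite -[x]scale1r; exact: lV. Qed.

Lemma subspaceZ V a x : linear_subspace V -> V x -> V (a *: x).
Proof. by move=> [V0 lV] Vx; rewrite -[_ *: _]addr0; exact: lV. Qed.

Lemma subspaceB V x y : linear_subspace V -> V x -> V y -> V (x - y).
Proof.
by move=> sV Vx Vy; apply: subspaceD => //; rewrite -scaleN1r; exact: subspaceZ.
Qed.

Lemma closed_subspace_sub V : closed_subspace V -> linear_subspace V.
Proof. by move=> /closed_subspace_adherentP[]. Qed.

Lemma closed_subspace_adh V x : closed_subspace V -> adherent V x -> V x.
Proof. by move=> /closed_subspace_adherentP[_]; apply. Qed.

Lemma closed_subspaceI V W :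
  closed_subspace V -> closed_subspace W -> closed_subspace (V `&` W).
Proof.
move=> [cV V0 lV] [cW W0 lW]; split; [exact: closedI|by []|].
by move=> a x y [? ?] [? ?]; split; [exact: lV|exact: lW].
Qed.

Lemma closed_subspace_bigcap (C : set (set H)) :
  C `<=` closed_subspace (H := H) -> closed_subspace (\bigcap_(V in C) V).
Proof.
move=> CV; split; first by apply: closed_bigI => V /CV[].
  by move=> V /CV[].
by move=> a x y Vx Vy V CVV; have [_ _] := CV V CVV; apply; [exact: Vx|exact: Vy].
Qed.

Lemma closed_subspace_span (X : set H) : closed_subspace (closed_span X).
Proof. by apply: closed_subspace_bigcap => V []. Qed.

Lemma sub_closed_span (X : set H) : X `<=` closed_span X.
Proof. exact: sub_smallest. Qed.

Lemma closed_span_sub (X V : set H) :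
  closed_subspace V -> X `<=` V -> closed_span X `<=` V.
Proof. exact: smallest_sub. Qed.

(** Stated on bare functions, since compositions and compressions of the given
operators have no bundled linear structure. *)
Definition bounded_linear T :=
  (forall (a : R[i]) x y, T (a *: x + y) = a *: T x + T y) /\
  exists2 c : R, 0 < c & forall x, rnorm (T x) <= c * rnorm x.

Lemma bounded_operatorP (T : {linear H -> H}) :
  bounded_operator T -> bounded_linear T.
Proof.
move=> /linear_boundedP/pinfty_ex_gt0[c c0 Tc].
split=> [a x y|]; first by rewrite linearP.
have [r r0 cr] := gt0_realC c0; exists r => // x.
by rewrite -lecR rmorphM/= -!rnormE -cr.
Qed.

Section BoundedLinear.
Variable T : H -> H.
Hypothesis bT : bounded_linear T.

Lemma blP a x y : T (a *: x + y) = a *: T x + T y. Proof. by case: bT. Qed.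
Lemma blD x y : T (x + y) = T x + T y.
Proof. by rewrite -[x]scale1r blP !scale1r. Qed.
Lemma bl0 : T 0 = 0.
Proof. by apply: (addrI (T 0)); rewrite -blD !addr0. Qed.
Lemma blZ a x : T (a *: x) = a *: T x.
Proof. by rewrite -[a *: x]addr0 blP bl0 addr0. Qed.
Lemma blB x y : T (x - y) = T x - T y.
Proof. by rewrite blD -scaleN1r blZ scaleN1r. Qed.
Lemma bl_sum n (f : 'I_n -> H) : T (\sum_i f i) = \sum_i T (f i).
Proof. by apply: (big_morph T); [exact: blD|exact: bl0]. Qed.

Lemma closed_subspace_preim V :
  closed_subspace V -> closed_subspace [set x | V (T x)].
Proof.
move=> cV; have [_ [c c0 Tc]] := bT; apply/closed_subspace_adherentP; split.
  split=> [|a x y /= Vx Vy]; first by rewrite /= bl0; case: cV.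
  by rewrite blP; case: cV => _ _; apply.
move=> x xV /=; apply: (closed_subspace_adh cV) => e e0.
have [|y Vy xy] := xV (e / c); first by rewrite divr_gt0.
exists (T y) => //; rewrite -blB (le_lt_trans (Tc _))//.
by rewrite mulrC -ltr_pdivlMr.
Qed.

End BoundedLinear.

Lemma closed_subspace0 : closed_subspace [set (0 : H)].
Proof.
apply/closed_subspace_adherentP; split.
  by split=> // a x y /= -> ->; rewrite scaler0 addr0.
move=> x x0 /=; apply: (@eq0_of_rnorm_small _ _ _ 1) => e e0.
by have [_ -> ] := x0 e e0; rewrite subr0 mul1r => /ltW.
Qed.

Lemma closed_subspace_ker T : bounded_linear T -> closed_subspace [set x | T x = 0].
Proof. by move=> bT; apply: (closed_subspace_preim bT closed_subspace0). Qed.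

Lemma bounded_linear_id : bounded_linear (fun x => x).
Proof. by split=> //; exists 1 => // x; rewrite mul1r. Qed.

Lemma bounded_linear_0 : bounded_linear (fun _ => 0).
Proof.
split=> [a x y|]; first by rewrite scaler0 addr0.
by exists 1 => // x; rewrite rnorm0 mul1r rnorm_ge0.
Qed.

Lemma bounded_linear_comp S T :
  bounded_linear S -> bounded_linear T -> bounded_linear (fun x => S (T x)).
Proof.
move=> [lS [s s0 Ss]] [lT [t t0 Tt]]; split=> [a x y|]; first by rewrite lT lS.
exists (s * t) => [|x]; first by rewrite mulr_gt0.
by rewrite (le_trans (Ss _))// -mulrA ler_pM2l.
Qed.

Lemma bounded_linear_lin a S T :
  bounded_linear S -> bounded_linear T -> bounded_linear (fun x => a *: S x + T x).
Proof.
move=> [lS [s s0 Ss]] [lT [t t0 Tt]]; split=> [b x y|].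
  by rewrite lS lT !scalerDr !scalerA (mulrC a b) addrACA.
exists (rnorm a * s + t) => [|x]; first by rewrite ltr_wpDl// mulr_ge0 ?rnorm_ge0 1?ltW.
rewrite (le_trans (rnormD _ _))// rnormZ mulrDl lerD// -mulrA.
by rewrite ler_wpM2l// rnorm_ge0.
Qed.

Lemma bounded_linear_iter n T : bounded_linear T -> bounded_linear (iter n T).
Proof.
move=> bT; elim: n => [|n IH]; first exact: bounded_linear_id.
exact: (bounded_linear_comp bT IH).
Qed.

Lemma closed_subspace_eigenspace T (a : R[i]) :
  bounded_linear T -> closed_subspace [set x | T x = a *: x].
Proof.
move=> bT; have := closed_subspace_ker (bounded_linear_lin (- a) bounded_linear_id bT).
congr closed_subspace; apply/seteqP; split=> x /=.
  by move/eqP; rewrite scaleNr addrC subr_eq0 => /eqP.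
by move=> ->; rewrite scaleNr addNr.
Qed.

End Metric.

(** * Cauchy sequences *)

Section Sequences.
Variables (R : realType) (H : completeNormedModType R[i]).

Lemma rnorm_cauchy_cvg (u : nat -> H) :
  (forall e : R, 0 < e -> exists N : nat, forall n m : nat, (N <= n)%N -> (N <= m)%N ->
     rnorm (u n - u m) < e) ->
  exists l, forall e : R, 0 < e -> exists N : nat, forall n : nat, (N <= n)%N ->
     rnorm (u n - l) < e.
Proof.
move=> uC; have cu : cvg (u @ \oo).
  apply/cauchy_cvgP/cauchy_ballP => e e0; have [r r0 er] := gt0_realC e0.
  have [N uN] := uC r r0.
  exists (u @` [set n | (N <= n)%N], u @` [set n | (N <= n)%N]).
    by split; exists N => // n Nn; exists n.
  move=> [_ _] /= [[n Nn <-] [m Nm <-]]; rewrite er.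
  by apply/rnorm_lt_ball; exact: uN.
exists (lim (u @ \oo)) => e e0.
have /cu[N _ uN] : nbhs (lim (u @ \oo)) [set y | rnorm (lim (u @ \oo) - y) < e].
  by apply/nbhs_rnorm; exists e.
by exists N => n /uN /=; rewrite rnormC.
Qed.

Lemma invr_lt_exists (e : R) : 0 < e ->
  exists N : nat, forall n : nat, (N <= n)%N -> n.+1%:R^-1 < e.
Proof.
move=> e0; exists (Num.truncn e^-1) => n Nn.
rewrite -[ltRHS]invrK ltf_pV2 ?posrE ?invr_gt0 ?ltr0n//.
by rewrite (lt_le_trans (truncnS_gt _))// ler_nat.
Qed.

End Sequences.

(** * Inner products and orthogonal projection *)

Section InnerProduct.
Variables (R : realType) (H : completeNormedModType R[i]).
Variables (dot : {dot H for Num.conj}) (hdot : hilbert_inner_product dot).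
Implicit Types (x y z u v w : H) (V W : set H).

Lemma dotDl x y z : dot (x + y) z = dot x z + dot y z.
Proof. exact: linearDl. Qed.

Lemma dotZl a x z : dot (a *: x) z = a * dot x z.
Proof. exact: linearZl_LR. Qed.

Lemma dotC x y : dot x y = Num.conj (dot y x).
Proof. by rewrite hermC expr0 mul1r. Qed.

Lemma dot0l y : dot 0 y = 0.
Proof. by rewrite -(scale0r 0) dotZl mul0r. Qed.

Lemma dotNl x z : dot (- x) z = - dot x z.
Proof. by rewrite -scaleN1r dotZl mulN1r. Qed.

Lemma dotBl x y z : dot (x - y) z = dot x z - dot y z.
Proof. by rewrite dotDl dotNl. Qed.

Lemma dot_eq0C x y : dot x y = 0 -> dot y x = 0.
Proof. by move=> xy; rewrite dotC xy rmorph0. Qed.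

Lemma dotDr x y z : dot x (y + z) = dot x y + dot x z.
Proof. by rewrite dotC dotDl rmorphD/= -!dotC. Qed.

Lemma dotNr x z : dot x (- z) = - dot x z.
Proof. by rewrite dotC dotNl rmorphN/= -dotC. Qed.

Lemma dotZr a x y : dot x (a *: y) = Num.conj a * dot x y.
Proof. by rewrite dotC dotZl rmorphM/= -dotC. Qed.

Lemma dotxx x : dot x x = (rnorm x ^+ 2)%:C.
Proof. by rewrite -hdot rnormE rmorphXn. Qed.

Lemma dotxx_eq0 x : dot x x = 0 -> x = 0.
Proof.
by rewrite dotxx => -[] /eqP; rewrite expf_eq0/= => /eqP; exact: rnorm_eq0.
Qed.

Lemma pythagoras x y : dot x y = 0 ->
  rnorm (x + y) ^+ 2 = rnorm x ^+ 2 + rnorm y ^+ 2.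
Proof.
move=> xy; apply: complexI; rewrite rmorphD/= -!dotxx dotDl !dotDr xy.
by rewrite (dot_eq0C xy) addr0 add0r.
Qed.

Lemma parallelogram x y :
  rnorm (x + y) ^+ 2 + rnorm (x - y) ^+ 2 = 2 * (rnorm x ^+ 2 + rnorm y ^+ 2).
Proof.
apply: complexI; rewrite rmorphM rmorph_nat !rmorphD/= -!dotxx dotBl dotDl !dotDr !dotNr.
by ring.
Qed.

(** Each vector is a multiple of y plus a vector orthogonal to y. *)
Lemma dot_residue_eq0 x y : y != 0 -> dot (x - (dot x y / dot y y) *: y) y = 0.
Proof.
move=> y0; rewrite dotBl dotZl divfK ?subrr//.
by apply: contra_neq y0; exact: dotxx_eq0.
Qed.

Lemma rnorm_sqr_residue x y : y != 0 ->
  rnorm x ^+ 2 = rnorm (dot x y) ^+ 2 / rnorm y ^+ 2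
                 + rnorm (x - (dot x y / dot y y) *: y) ^+ 2.
Proof.
move=> y0; have y0' := rnorm_gt0 y0.
have ry : dot ((dot x y / dot y y) *: y) (x - (dot x y / dot y y) *: y) = 0.
  by rewrite dotZl (dot_eq0C (dot_residue_eq0 x y0)) mulr0.
rewrite -{1}(subrKC ((dot x y / dot y y) *: y) x) (pythagoras ry).
congr (_ + _); rewrite rnormZ rnormM rnormV dotxx rnorm_real ?sqr_ge0//.
by field; rewrite gt_eqF.
Qed.

Lemma cauchy_schwarz x y : rnorm (dot x y) <= rnorm x * rnorm y.
Proof.
have [->|y0] := eqVneq y 0; first by rewrite dotC dot0l rmorph0 !rnorm0 mulr0.
rewrite -(ler_pXn2r (n := 2))// ?nnegrE ?mulr_ge0 ?rnorm_ge0// exprMn.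
rewrite (rnorm_sqr_residue x y0) mulrDl divfK; last first.
  by rewrite expf_eq0/= gt_eqF// rnorm_gt0.
by rewrite lerDl mulr_ge0// sqr_ge0.
Qed.

Definition orthogonal_set (X : set H) : set H := [set x | forall y, X y -> dot x y = 0].

Lemma closed_subspace_orthogonal X : closed_subspace (orthogonal_set X).
Proof.
apply/closed_subspace_adherentP; split.
  split=> [y _|a x y Xx Xy z Xz]; first exact: dot0l.
  by rewrite dotDl dotZl Xx// Xy// mulr0 addr0.
move=> x xX y Xy; apply: (@eq0_of_rnorm_small _ _ _ (rnorm y)) => e e0.
have [z zX xz] := xX e e0.
rewrite -[x](subrK z) dotDl (zX y Xy) addr0 (le_trans (cauchy_schwarz _ _))//.
by rewrite mulrC ler_wpM2l ?rnorm_ge0// ltW.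
Qed.

Lemma orthogonal_self X x : X x -> orthogonal_set X x -> x = 0.
Proof. by move=> Xx /(_ x Xx); exact: dotxx_eq0. Qed.

(** Moving from u to u + a w, with a the coefficient of the projection of x -
u on w, would shorten the distance by the norm of a w. *)
Lemma minimizer_orthogonal W x u : linear_subspace W -> W u ->
  (forall w, W w -> rnorm (x - u) <= rnorm (x - w)) ->
  orthogonal_set W (x - u).
Proof.
move=> sW Wu minu w Ww; have [->|w0] := eqVneq w 0; first by rewrite dotC dot0l rmorph0.
set a := dot (x - u) w / dot w w.
have := minu (u + a *: w) (subspaceD sW Wu (subspaceZ _ sW Ww)).
rewrite opprD addrA -(ler_pXn2r (n := 2))// ?nnegrE ?rnorm_ge0//.
rewrite (rnorm_sqr_residue (x - u) w0) -/a gerDr => le0.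
apply: rnorm_eq0; apply/eqP; rewrite -sqrf_eq0 eq_le sqr_ge0 andbT.
by move: le0; rewrite ler_pdivrMr ?mul0r// exprn_gt0// rnorm_gt0.
Qed.

(** A minimizing sequence is Cauchy by the parallelogram law. *)
Lemma exists_projection W x : closed_subspace W ->
  exists2 u, W u & orthogonal_set W (x - u).
Proof.
move=> cW; have sW := closed_subspace_sub cW.
pose D := [set rnorm (x - w) ^+ 2 | w in W].
have D0 : has_inf D.
  split; first by exists (rnorm (x - 0) ^+ 2); exists 0 => //; case: cW.
  by exists 0 => _ [w _ <-]; rewrite sqr_ge0.
have infD w : W w -> inf D <= rnorm (x - w) ^+ 2.
  by move=> Ww; apply: inf_lbound; [case: D0|exists w].
have /choice[u uP] (n : nat) : exists w, W w /\ rnorm (x - w) ^+ 2 < inf D + n.+1%:R^-1.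
  have n0 : 0 < n.+1%:R^-1 :> R by rewrite invr_gt0 ltr0n.
  have [_ [w Ww <-] wD] := inf_adherent n0 D0.
  by exists w.
have close n m : rnorm (u n - u m) ^+ 2 <= 2 * (n.+1%:R^-1 + m.+1%:R^-1).
  have [[Wn un] [Wm um]] := (uP n, uP m).
  have := parallelogram (x - u n) (x - u m).
  have -> : x - u n - (x - u m) = - (u n - u m) by rewrite !opprB addrC addrA subrK.
  have -> : x - u n + (x - u m) = 2%:C *: (x - 2%:C^-1 *: (u n + u m)).
    rewrite scalerBr scalerA divff ?scale1r; last by rewrite eq_complex/= pnatr_eq0.
    by rewrite (_ : 2%:C = 1 + 1) ?rmorphD// scalerDl !scale1r opprD addrACA.
  rewrite rnormN rnormZ rnorm_real// exprMn.
  have := infD (2%:C^-1 *: (u n + u m)) (subspaceZ _ sW (subspaceD sW Wn Wm)).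
  by move: un um; move: n.+1%:R^-1 m.+1%:R^-1 => i j; lra.
have [l ul] : exists l, forall e : R, 0 < e -> exists N : nat,
    forall n : nat, (N <= n)%N -> rnorm (u n - l) < e.
  apply: rnorm_cauchy_cvg => e e0.
  have e4 : 0 < e ^+ 2 / 4 by rewrite divr_gt0// exprn_gt0.
  have [N NP] := invr_lt_exists e4.
  exists N => n m /NP Nn /NP Nm.
  rewrite -(ltr_pXn2r (n := 2))// ?nnegrE ?rnorm_ge0 1?ltW//.
  rewrite (le_lt_trans (close n m))//.
  by move: Nn Nm; move: n.+1%:R^-1 m.+1%:R^-1 => i j; lra.
have Wl : W l.
  apply: (closed_subspace_adh cW) => e e0; have [N NP] := ul e e0.
  by exists (u N); [case: (uP N)|rewrite rnormC NP].
exists l => //; apply: minimizer_orthogonal => // w Ww.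
apply/ler_addgt0Pl => e e0.
have e2 : 0 < e / 2 by rewrite divr_gt0.
have [N NP] := ul _ e2.
have [M MP] := invr_lt_exists (exprn_gt0 2 e2).
have Nn := NP (N + M)%N (leq_addr _ _); have Mn := MP (N + M)%N (leq_addl _ _).
have [_ un] := uP (N + M)%N; have dw := infD w Ww.
have {}un : rnorm (x - u (N + M)%N) < rnorm (x - w) + e / 2.
  rewrite -(ltr_pXn2r (n := 2))// ?nnegrE ?addr_ge0 ?rnorm_ge0 1?ltW// ?divr_gt0//.
  rewrite sqrrD.
  have : 0 <= rnorm (x - w) * (e / 2) by rewrite mulr_ge0 ?rnorm_ge0// ltW// divr_gt0.
  by move: un Mn; move: (_.+1%:R^-1) => i; lra.
by have := rnormB x (u (N + M)%N) l; lra.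
Qed.

(** Q is the projection with kernel W. It serves as the quotient map by W. *)
Lemma orthogonal_complement_decomposition W : closed_subspace W ->
  exists Q : H -> H, [/\ bounded_linear Q,
    forall x, W (x - Q x) & forall x, orthogonal_set W (Q x)].
Proof.
move=> cW; have sW := closed_subspace_sub cW.
have /choice[P PP] x : exists u, W u /\ orthogonal_set W (x - u).
  by have [u ? ?] := exists_projection x cW; exists u.
have WP x : W (P x) by case: (PP x).
have oP x : orthogonal_set W (x - P x) by case: (PP x).
have sO := closed_subspace_sub (closed_subspace_orthogonal W).
exists (fun x => x - P x); split=> [|x|//]; last by rewrite opprB addrC subrK.
split=> [a x y|].
  apply/eqP; rewrite -subr_eq0; apply/eqP; apply: (orthogonal_self (X := W)); last first.
    apply: (subspaceB sO); first exact: oP.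
    by apply: sO.2; exact: oP.
  have -> : a *: x + y - P (a *: x + y) - (a *: (x - P x) + (y - P y)) =
      a *: P x + P y - P (a *: x + y).
    have -> : a *: (x - P x) + (y - P y) = a *: x + y - (a *: P x + P y).
      by rewrite scalerBr addrACA opprD.
    by rewrite opprB addrC addrA subrK.
  by apply: (subspaceB sW) => //; exact: sW.2.
exists 1 => // x; rewrite mul1r -(ler_pXn2r (n := 2))// ?nnegrE ?rnorm_ge0//.
rewrite -[x in leRHS](subrK (P x)) (pythagoras (oP x _ (WP x))).
by rewrite lerDl sqr_ge0.
Qed.

End InnerProduct.

(** * Elementary growth estimates *)

Section RealSequences.
Variable R : realType.
Implicit Types (h q C : R).

Lemma bernoulli_sub h n : 0 <= h <= 1 -> 1 - n%:R * h <= (1 - h) ^+ n.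
Proof.
move=> /andP[h0 h1]; elim: n => [|n IH]; first by rewrite mul0r subr0.
have : (1 - n%:R * h) * (1 - h) <= (1 - h) ^+ n * (1 - h).
  by rewrite ler_wpM2r// subr_ge0.
rewrite -exprSr; apply: le_trans; rewrite -natr1.
have : 0 <= n%:R * h * h by rewrite !mulr_ge0.
lra.
Qed.

Lemma bernoulli_add h n : 0 <= h -> 1 + n%:R * h <= (1 + h) ^+ n.
Proof.
move=> h0; elim: n => [|n IH]; first by rewrite mul0r addr0.
have : (1 + n%:R * h) * (1 + h) <= (1 + h) ^+ n * (1 + h).
  by rewrite ler_wpM2r// addr_ge0.
rewrite -exprSr; apply: le_trans; rewrite -natr1.
have : 0 <= n%:R * h * h by rewrite !mulr_ge0.
lra.
Qed.

(** For small h the ratio 1 / (1 - h) works, by the Bernoulli inequality for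
(1 - h)^n. *)
Lemma exists_small_ratio n : exists2 q : R, 1 < q & q ^+ n <= 2.
Proof.
pose h : R := (2 * n.+1%:R)^-1.
have h0 : 0 < h by rewrite invr_gt0 mulr_gt0 ?ltr0n.
have nh : n.+1%:R * h = 2^-1 by rewrite /h invfM mulrCA divff ?mulr1// pnatr_eq0.
have h1 : h <= 2^-1 by rewrite -nh ler_peMl ?(ltW h0) ?ler1n.
exists (1 - h)^-1; first by rewrite invf_gt1; lra.
rewrite exprVn invf_ple ?posrE ?exprn_gt0; last by lra.
  rewrite (le_trans _ (bernoulli_sub n _))//; last by apply/andP; split; lra.
  have : n%:R * h <= n.+1%:R * h by rewrite ler_wpM2r ?(ltW h0) ?ler_nat.
  by lra.
all: lra.
Qed.

Lemma exponential_unbounded q C : 1 < q -> exists n, C <= q ^+ n.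
Proof.
move=> q1; have h0 : 0 < q - 1 by lra.
exists (Num.truncn (C / (q - 1))).+1.
have := bernoulli_add (Num.truncn (C / (q - 1))).+1 (ltW h0).
rewrite subrKC; apply: le_trans.
have : C / (q - 1) < (Num.truncn (C / (q - 1))).+1%:R by exact: truncnS_gt.
by rewrite ltr_pdivrMr//; lra.
Qed.

(** For an even exponent 2k, the square of the Bernoulli bound on q^k is
already quadratic in k. *)
Lemma exponential_dominates_linear q C (m : nat) : 1 < q ->
  exists2 n : nat, (m < n)%N & C * (1 + 2 * n%:R) <= q ^+ n.
Proof.
move=> q1; have h0 : 0 < q - 1 by lra.
have hh : 0 < (q - 1) ^+ 2 by rewrite exprn_gt0.
(* Since 1 + 4 k <= 5 k for k >= 1, it is enough that 5 |C| <= k (q - 1)^2. *)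
pose k := (maxn m (Num.truncn (5 * `|C| / (q - 1) ^+ 2))).+1.
exists (k * 2)%N.
  by rewrite /k; have := leq_maxl m (Num.truncn (5 * `|C| / (q - 1) ^+ 2)); lia.
have k1 : 1 <= k%:R :> R by rewrite ler1n.
have : 5 * `|C| <= k%:R * (q - 1) ^+ 2.
  rewrite -ler_pdivrMr// ltW// (lt_le_trans (truncnS_gt _))// ler_nat ltnS.
  exact: leq_maxr.
have := bernoulli_add k (ltW h0); rewrite subrKC => qk.
have {}qk : (k%:R * (q - 1)) ^+ 2 <= (q ^+ k) ^+ 2.
  by rewrite ler_pXn2r ?nnegrE ?exprn_ge0 ?mulr_ge0//; lra.
rewrite -exprM in qk => Ck; apply: le_trans qk; rewrite exprMn.
have : k%:R * (5 * `|C|) <= k%:R * (k%:R * (q - 1) ^+ 2) by rewrite ler_wpM2l.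
have : C * (1 + 2 * (k * 2)%:R) <= `|C| * (5 * k%:R).
  have c1 := ler_norm C; rewrite (le_trans (y := `|C| * (1 + 2 * (k * 2)%:R)))//.
    by rewrite ler_wpM2r// addr_ge0// mulr_ge0.
  by rewrite ler_wpM2l// natrM; lra.
by rewrite expr2; lra.
Qed.

End RealSequences.

(** * Averages over roots of unity *)

Section RootsOfUnity.
Variable R : realType.

Lemma exists_primitive_root N : (0 < N)%N -> exists w : R[i], N.-primitive_root w.
Proof.
move=> N0; have [rs] := closed_field_poly_normal ('X^N - 1 : {poly R[i]}).
rewrite (monicP (monicXnsubC _ N0)) scale1r => rsP.
have /hasP[] : has N.-primitive_root rs; last by move=> w _ wN; exists w.
apply: has_prim_root => //.
- by apply/allP => z; rewrite -root_prod_XsubC -rsP.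
- by rewrite -separable_prod_XsubC -rsP separable_Xn_sub_1// pnatr_eq0 -lt0n.
- by rewrite -ltnS -(size_prod_XsubC rs id) -rsP size_XnsubC.
Qed.

Lemma sum_root_of_unity (y : R[i]) N : y ^+ N = 1 ->
  \sum_(j < N) y ^+ j = if y == 1 then N%:R else 0.
Proof.
move=> yN; case: eqVneq => [->|y1].
  by under eq_bigr do rewrite expr1n; rewrite sumr_const card_ord.
have : (y - 1) * \sum_(j < N) y ^+ j = 0 by rewrite -subrX1 yN subrr.
by move/eqP; rewrite mulf_eq0 subr_eq0 (negPf y1) => /eqP.
Qed.

Lemma rnorm_root_of_unity (y : R[i]) N : (0 < N)%N -> y ^+ N = 1 -> rnorm y = 1.
Proof.
move=> N0 yN; apply/eqP; rewrite -(pexpr_eq1 (n := N)) ?rnorm_ge0//.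
by rewrite -rnormX yN (rnorm_real (t := 1)).
Qed.

Variables (H : completeNormedModType R[i]).

(** The discrete form of Cauchy's coefficient formula: the multiplier w^(j(N -
n)) is w^(-jn), and the sum over j kills every m other than n. *)
Lemma fourier_coefficient (f : nat -> H) (w : R[i]) N n :
  N.-primitive_root w -> (n < N)%N ->
  \sum_(j < N) w ^+ (j * (N - n)) *: (\sum_(m < N) (w ^+ j) ^+ m *: f m)
  = f n *+ N.
Proof.
move=> pw nN.
under eq_bigr do rewrite scaler_sumr.
rewrite exchange_big/= (bigD1 (Ordinal nN))//= [X in _ + X]big1 ?addr0.
  rewrite -scaler_nat; under eq_bigr do rewrite scalerA -!exprM -exprD -mulnDr subnK 1?ltnW//.
  rewrite -scaler_suml; congr (_ *: _).
  under eq_bigr do rewrite mulnC exprM (prim_expr_order pw) expr1n.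
  by rewrite sumr_const card_ord.
move=> m mn; rewrite -[RHS](scale0r (f m)).
under eq_bigr do rewrite scalerA -!exprM -exprD -mulnDr mulnC exprM.
rewrite -scaler_suml sum_root_of_unity; last first.
  by rewrite -exprM mulnC exprM (prim_expr_order pw) expr1n.
rewrite ifF//; apply/negP; rewrite -(prim_order_dvd pw) => /dvdnP[k].
have mN := ltn_ord m; move/eqP: mn => mn km.
have : k = 1%N by nia.
move=> k1; apply: mn; apply: val_inj => /=; lia.
Qed.

End RootsOfUnity.

(** * Compactness relative to a subspace *)

Section CompactOperators.
Variables (R : realType) (H : completeNormedModType R[i]).
Implicit Types (E : set H) (T K : H -> H) (x y z w : H).

(** The sequential form is what every argument below consumes: a cluster point
of the images of one bounded sequence. *)
Definition compact_on E K := forall (r : R) (x : nat -> H),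
  (forall n, E (x n)) -> (forall n, rnorm (x n) <= r) ->
  exists w, forall (e : R) (N : nat), 0 < e ->
    exists2 n : nat, (N <= n)%N & rnorm (K (x n) - w) < e.

Lemma compact_operator_compact_on E K :
  bounded_linear K -> compact_operator K -> compact_on E K.
Proof.
move=> bK cK r x _ xr; pose s := Num.max r 1.
have s0 : 0 < s by rewrite lt_max ltr01 orbT.
have sC0 : s%:C != 0 :> R[i] by rewrite eq_complex/= eqxx andbT gt_eqF.
pose y n := s%:C^-1 *: x n.
pose F : set_system H := (fun n => K (y n)) @ \oo.
have F_in N : F [set K (y n) | n in [set n | (N <= n)%N]].
  by exists N => // n Nn; exists n.
move: cK; rewrite /compact_operator precompactE => /(_ F _)[].
  exists 0%N => // n _; apply: subset_closure; exists (y n) => //=.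
  rewrite rnormE (_ : 1 = 1%:C)// lecR rnormZ rnormV rnorm_real ?(ltW s0)//.
  by rewrite mulrC ler_pdivrMr// mul1r (le_trans (xr n))// le_max lexx.
move=> w [_ wF]; exists (s%:C *: w) => e N e0.
have [|_ [[n Nn <-] /= nw]] := wF _ [set v | rnorm (w - v) < e / s] (F_in N).
  by apply/nbhs_rnorm; exists (e / s) => //; rewrite divr_gt0.
exists n => //; have -> : x n = s%:C *: y n by rewrite scalerA divff// scale1r.
rewrite (blZ bK) -scalerBr rnormZ rnorm_real ?(ltW s0)// rnormC mulrC.
by rewrite -ltr_pdivlMr.
Qed.

Lemma compact_on_comp E T K :
  bounded_linear T -> compact_on E K -> compact_on E (fun x => T (K x)).
Proof.
move=> bT cK r x xE xr; have [w wP] := cK r x xE xr; exists (T w) => e N e0.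
have [_ [c c0 Tc]] := bT; have [|n Nn nw] := wP (e / c) N; first by rewrite divr_gt0.
exists n => //; rewrite -(blB bT) (le_lt_trans (Tc _))//.
by rewrite mulrC -ltr_pdivlMr.
Qed.

Lemma compact_on_ext E K T :
  (forall x, E x -> K x = T x) -> compact_on E K -> compact_on E T.
Proof.
move=> KT cK r x xE xr; have [w wP] := cK r x xE xr; exists w => e N e0.
by have [n Nn nw] := wP e N e0; exists n => //; rewrite -KT.
Qed.

(** The eigenvalue 0 is excluded too, so K is injective on E. *)
Definition eigenvalue_free E K := forall (a : R[i]) x,
  E x -> K x = a *: x -> x = 0.

End CompactOperators.

(** * Compact operators without eigenvectors are quasinilpotent *)

Section Quasinilpotence.
Variables (R : realType) (H : completeNormedModType R[i]).
Variables (dot : {dot H for Num.conj}) (hdot : hilbert_inner_product dot).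
Variables (E : set H) (K : H -> H).
Hypotheses (cE : closed_subspace E) (bK : bounded_linear K).
Hypotheses (KE : forall x, E x -> E (K x)) (cK : compact_on E K).
Hypothesis noeig : eigenvalue_free E K.
Implicit Types (x y w : H) (z : R[i]).

(** Otherwise there are unit vectors x_n and scalars z_n in the disc with x_n
- z_n K x_n tending to 0. Since z_n K x_n = K (z_n x_n) clusters at some w, so
does x_n, and z_n K w is then close to w infinitely often. Thus w lies in the
line of K w, which makes w an eigenvector of K. *)
Lemma resolvent_bounded_below (r : R) : 0 < r -> exists2 d : R, 0 < d &
  forall z x, rnorm z <= r -> E x -> d * rnorm x <= rnorm (x - z *: K x).
Proof.
move=> r0; have sE := closed_subspace_sub cE.
have [_ [c c0 Kc]] := bK.
apply: contrapT => nbd.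
have /choice[zx zxP] (n : nat) : exists zx : R[i] * H,
    [/\ rnorm zx.1 <= r, E zx.2, rnorm zx.2 = 1 &
        rnorm (zx.2 - zx.1 *: K zx.2) < n.+1%:R^-1].
  apply: contrapT => nP; apply: nbd; exists n.+1%:R^-1; first by rewrite invr_gt0 ltr0n.
  move=> z x zr Ex; rewrite leNgt; apply/negP => zx; apply: nP.
  have x0 : x != 0 by apply: contraTneq zx => ->; rewrite rnorm0 mulr0 -leNgt rnorm_ge0.
  have nx0 := rnorm_gt0 x0; exists (z, (rnorm x)%:C^-1 *: x); split=> //=.
  - exact: subspaceZ.
  - by rewrite rnormZ rnormV rnorm_real ?rnorm_ge0// mulVf// gt_eqF.
  rewrite (blZ bK) scalerA mulrC -scalerA -scalerBr rnormZ rnormV rnorm_real ?rnorm_ge0//.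
  by rewrite mulrC ltr_pdivrMr.
pose z n := (zx n).1; pose x n := (zx n).2.
have [||w wP] := cK (r := r) (x := fun n => z n *: x n).
- by move=> n; have [? ? ? ?] := zxP n; exact: subspaceZ.
- by move=> n; have [? _ xn _] := zxP n; rewrite rnormZ /x xn mulr1.
have approx (e : R) : 0 < e -> exists n, rnorm (x n - w) < 2 * e /\
    rnorm (z n *: K (x n) - w) < e.
  move=> e0; have [N NP] := invr_lt_exists e0; have [n Nn nw] := wP e N e0.
  rewrite (blZ bK) in nw; exists n; split=> //.
  have [_ _ _ xn] := zxP n; have := rnormB (x n) (z n *: K (x n)) w.
  by have := lt_trans xn (NP n Nn); rewrite -/(z n) -/(x n); lra.
have Ew : E w.
  apply: (closed_subspace_adh cE) => e e0.
  have [|n [xw _]] := approx (e / 2); first by rewrite divr_gt0.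
  by exists (x n); [case: (zxP n)|rewrite rnormC; lra].
have w0 : w != 0.
  apply: contraPneq isT => w0; have [|n []] := approx (4^-1); first by rewrite invr_gt0.
  by rewrite w0 subr0 /x; have [_ _ -> _] := zxP n; lra.
have approxK (e : R) : 0 < e -> exists n, rnorm (z n *: K w - w) <= e * (2 * r * c + 1).
  move=> e0; have [n [xw zKw]] := approx e e0; exists n.
  have zr : rnorm (z n) <= r by case: (zxP n).
  have -> : z n *: K w - w = - (z n *: K (x n - w)) + (z n *: K (x n) - w).
    by rewrite (blB bK) scalerBr opprB addrA subrK.
  rewrite (le_trans (rnormD _ _))// rnormN rnormZ.
  have := Kc (x n - w).
  have : rnorm (z n) * rnorm (K (x n - w)) <= r * (c * (2 * e)).
    rewrite ler_pM ?rnorm_ge0// (le_trans (Kc _))// ler_pM2l//; lra.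
  lra.
have Kw0 : K w != 0.
  apply: contra_neq w0 => Kw0; apply: (@eq0_of_rnorm_small _ _ _ (2 * r * c + 1)) => e e0.
  have [n] := approxK e e0; rewrite Kw0 scaler0 sub0r rnormN; lra.
(* The candidate for the reciprocal eigenvalue: a *: K w is the projection of
w on the line of K w. *)
pose a := dot w (K w) / dot (K w) (K w).
have orth : dot (w - a *: K w) (K w) = 0 by exact: dot_residue_eq0.
have wK : w - a *: K w = 0.
  apply: (@eq0_of_rnorm_small _ _ _ (2 * r * c + 1)) => e e0.
  have [n zn] := approxK e e0; rewrite mulrC; apply: le_trans zn.
  rewrite [leRHS]rnormC -(ler_pXn2r (n := 2))// ?nnegrE ?rnorm_ge0//.
  have -> : w - z n *: K w = w - a *: K w + (a - z n) *: K w.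
    by rewrite scalerBl addrA subrK.
  have /(pythagoras hdot)-> : dot (w - a *: K w) ((a - z n) *: K w) = 0.
    by rewrite dotZr orth mulr0.
  by rewrite lerDl sqr_ge0.
have a0 : a != 0.
  by apply: contra_neq w0 => a0; rewrite a0 scale0r subr0 in wK.
case/eqP: w0; apply: (noeig (a := a^-1)) => //.
move/eqP: wK; rewrite subr_eq0 => /eqP wK.
by rewrite [in RHS]wK scalerA mulVf// scale1r.
Qed.

Let neumann_term z x m := z ^+ m *: iter m K x.

Lemma neumann_termS z x m : z *: K (neumann_term z x m) = neumann_term z x m.+1.
Proof. by rewrite /neumann_term (blZ bK) scalerA -exprS. Qed.

Lemma scaleKMn z y n : z *: K (y *+ n) = (z *: K y) *+ n.
Proof.
by rewrite -(scaler_nat n y) -(scaler_nat n (z *: _)) (blZ bK) !scalerA mulrC.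
Qed.

(** Telescoping: multiplication by z K shifts the terms. *)
Lemma neumann_sum_resolvent z x N :
  (\sum_(m < N) neumann_term z x m) - z *: K (\sum_(m < N) neumann_term z x m)
  = x - neumann_term z x N.
Proof.
elim: N => [|N IH].
  by rewrite big_ord0 (bl0 bK) scaler0 subr0 /neumann_term scale1r subrr.
rewrite big_ord_recr/= (blD bK) scalerDr opprD addrACA IH.
by rewrite neumann_termS addrA subrK.
Qed.

(** Up to remainders, the sums of (m+1) z^m K^m x are sent by 1 - zK to those
of z^m K^m x, and these to x: they approximate (1 - zK)^-2 x. *)
Lemma neumann_derivative_resolvent z x N (g := \sum_(m < N) neumann_term z x m *+ m.+1) :
  g - z *: K g = \sum_(m < N) neumann_term z x m - neumann_term z x N *+ N.
Proof.
rewrite {}/g; elim: N => [|N IH].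
  by rewrite !big_ord0 (bl0 bK) scaler0.
rewrite !big_ord_recr/= (blD bK) scalerDr opprD addrACA IH scaleKMn neumann_termS.
by rewrite (mulrSr (neumann_term z x N)) !addrA subrK.
Qed.

(** Holds for every t exactly when K is quasinilpotent on E. *)
Definition power_bounded (t : R) := exists2 C : R, 0 <= C &
  forall n x, E x -> t ^+ n * rnorm (iter n K x) <= C * rnorm x.

Lemma iter_stable n x : E x -> E (iter n K x).
Proof. by elim: n => //= n IH /IH; exact: KE. Qed.

(** Two applications of the lower bound for 1 - zK leave x plus remainders of
order N t^N |K^N x|; these are at most |x| once N is large, because the powers
are controlled on the bigger radius t q. *)
Lemma neumann_derivative_bound (t d C q : R) z x N :
  0 <= t -> 1 < q -> 0 <= C -> E x -> 0 < d -> rnorm z = t ->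
  (forall y, E y -> d * rnorm y <= rnorm (y - z *: K y)) ->
  (forall n, (t * q) ^+ n * rnorm (iter n K x) <= C * rnorm x) ->
  C * (1 + 2 * N%:R) <= q ^+ N ->
  d ^+ 2 * rnorm (\sum_(m < N) neumann_term z x m *+ m.+1) <= 2 * rnorm x.
Proof.
move=> t0 q1 C0 Ex d0 zt lowd Ct Nbig; have sE := closed_subspace_sub cE.
have tE n : E (neumann_term z x n) by apply: subspaceZ => //; exact: iter_stable.
have sumE (f : nat -> H) : (forall n, E (f n)) -> E (\sum_(m < N) f m).
  move=> fE; elim/big_rec : _ => [|m y _ Ey]; first by case: sE.
  exact: subspaceD.
have ES : E (\sum_(m < N) neumann_term z x m) by exact: sumE.
have Eg : E (\sum_(m < N) neumann_term z x m *+ m.+1).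
  by apply: (sumE (fun m => neumann_term z x m *+ m.+1)) => m;
    rewrite -scaler_nat; exact: subspaceZ.
have tn n : q ^+ n * rnorm (neumann_term z x n) <= C * rnorm x.
  rewrite /neumann_term rnormZ rnormX zt mulrA -exprMn mulrC.
  by rewrite mulrC (mulrC q).
have tN : rnorm (neumann_term z x N) + N%:R *
    (rnorm (neumann_term z x N) + rnorm (neumann_term z x N.+1)) <= rnorm x.
  have qN0 : 0 < q ^+ N by rewrite exprn_gt0//; lra.
  rewrite -(ler_pM2l qN0); set e0 := rnorm (neumann_term z x N).
  set e1 := rnorm (neumann_term _ _ _).
  have h0 : q ^+ N * e0 <= C * rnorm x by exact: tn.
  have h1 : q ^+ N * e1 <= C * rnorm x.
    rewrite (le_trans _ (tn N.+1))// exprSr -mulrA ler_pM2l// ler_peMl ?rnorm_ge0//.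
    by lra.
  rewrite (le_trans (y := C * (1 + 2 * N%:R) * rnorm x))//; last first.
    by rewrite ler_wpM2r ?rnorm_ge0.
  have : N%:R * (q ^+ N * (e0 + e1)) <= N%:R * (2 * (C * rnorm x)).
    by rewrite ler_wpM2l//; lra.
  by lra.
have := lowd _ Eg; rewrite neumann_derivative_resolvent => h.
have {}h : d ^+ 2 * rnorm (\sum_(m < N) neumann_term z x m *+ m.+1) <=
    d * rnorm (\sum_(m < N) neumann_term z x m - neumann_term z x N *+ N).
  by rewrite expr2 -mulrA ler_pM2l.
apply: (le_trans h).
have : E (\sum_(m < N) neumann_term z x m - neumann_term z x N *+ N).
  by apply: subspaceB => //; rewrite -scaler_nat; exact: subspaceZ.
move=> /lowd; move=> h'; apply: (le_trans h').
rewrite (blB bK) scalerBr opprD addrACA neumann_sum_resolvent scaleKMn neumann_termS.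
rewrite (le_trans (rnormD _ _))// (le_trans (lerD (rnormD _ _) (rnormD _ _)))//.
by rewrite opprK !rnormN !rnormMn; lra.
Qed.

(** The coefficient of index n in the sums bounded above is (n+1) t^n K^n x,
and it is the average of their values at the points t w^j. The factor n+1 on
the left is the gain of this estimate: neither d nor the right-hand side
depends on n or t. *)
Lemma power_bound_of_resolvent_bound (r d t q : R) n x : 0 < t -> t <= r -> 1 < q ->
  0 < d ->
  (forall z y, rnorm z <= r -> E y -> d * rnorm y <= rnorm (y - z *: K y)) ->
  power_bounded (t * q) -> E x ->
  d ^+ 2 * (n.+1%:R * (t ^+ n * rnorm (iter n K x))) <= 2 * rnorm x.
Proof.
move=> t0 tr q1 d0 lowd [C C0 Ct] Ex.
have [N nN Nbig] := exponential_dominates_linear C n q1.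
have N0 : (0 < N)%N by exact: leq_ltn_trans nN.
have [w pw] := exists_primitive_root R N0.
have wN j : rnorm (w ^+ j) = 1.
  by rewrite rnormX (rnorm_root_of_unity N0 (prim_expr_order pw)) expr1n.
have bound z : rnorm z = t ->
    d ^+ 2 * rnorm (\sum_(m < N) neumann_term z x m *+ m.+1) <= 2 * rnorm x.
  move=> zt; apply: (neumann_derivative_bound (ltW t0) q1 C0 Ex d0 zt _ _ Nbig).
    by move=> y Ey; apply: lowd => //; rewrite zt.
  by move=> m; exact: Ct.
pose f m := neumann_term t%:C x m *+ m.+1.
have fn : rnorm (f n *+ N) = N%:R * (n.+1%:R * (t ^+ n * rnorm (iter n K x))).
  by rewrite /f /neumann_term !rnormMn rnormZ rnormX (rnorm_real (ltW t0)).
have N0' : 0 < N%:R :> R by rewrite ltr0n.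
rewrite -(ler_pM2l N0') mulrCA -fn -(fourier_coefficient f pw nN).
have d20 : 0 <= d ^+ 2 by rewrite sqr_ge0.
rewrite (le_trans (ler_wpM2l d20 (rnorm_sum _)))// mulr_sumr.
rewrite (le_trans (y := \sum_(j < N) 2 * rnorm x))//; last first.
  by rewrite sumr_const card_ord [leRHS]mulr_natl.
apply: ler_sum => j _; rewrite rnormZ wN mul1r.
have -> : \sum_(m < N) (w ^+ j) ^+ m *: f m =
    \sum_(m < N) neumann_term (w ^+ j * t%:C) x m *+ m.+1.
  by apply: eq_bigr => m _; rewrite /f /neumann_term -scalerMnr scalerA -exprMn.
by apply: bound; rewrite rnormM wN mul1r (rnorm_real (ltW t0)).
Qed.

Lemma power_bounded_le (s t : R) : 0 <= s -> s <= t -> power_bounded t -> power_bounded s.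
Proof.
move=> s0 st [C C0 Ct]; exists C => // n x Ex; rewrite (le_trans _ (Ct n x Ex))//.
by rewrite ler_wpM2r ?rnorm_ge0// lerXn2r// nnegrE// (le_trans s0).
Qed.

(** Divide the exponent by n: the quotient contracts, and the remainder costs
a bounded factor. *)
Lemma power_bounded_of_contraction (s : R) n : 0 < s -> (0 < n)%N ->
  (forall x, E x -> s ^+ n * rnorm (iter n K x) <= rnorm x) -> power_bounded s.
Proof.
move=> s0 n0 sn; have [_ [c c0 Kc]] := bK; pose b := Num.max 1 (s * c).
have b1 : 1 <= b by rewrite le_max lexx.
have sb : s * c <= b by rewrite le_max lexx orbT.
exists (b ^+ n) => [|m x Ex]; first by rewrite exprn_ge0// (le_trans _ b1).
have small l : s ^+ l * rnorm (iter l K x) <= b ^+ l * rnorm x.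
  elim: l => [|l IH]; first by rewrite !mul1r.
  rewrite !exprS iterS (le_trans (y := (s * c) * (s ^+ l * rnorm (iter l K x))))//.
    rewrite -!mulrA ler_pM2l// [leRHS]mulrCA ler_pM2l ?exprn_gt0//.
  by rewrite -[leRHS]mulrA ler_pM// !mulr_ge0// ?rnorm_ge0// ?exprn_ge0// ltW.
have multiple k y : E y -> s ^+ (n * k) * rnorm (iter (n * k) K y) <= rnorm y.
  elim: k y => [|k IH] y Ey; first by rewrite muln0 mul1r.
  rewrite mulnS exprD iterD mulrAC (le_trans _ (IH y Ey))// mulrC.
  by rewrite ler_pM2l ?exprn_gt0// sn//; exact: iter_stable.
rewrite {1 2}(divn_eq m n) mulnC addnC exprD addnC iterD -mulrA.
rewrite (le_trans (y := s ^+ (m %% n) * rnorm (iter (m %% n) K x)))//.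
  by rewrite ler_pM2l ?exprn_gt0// multiple//; exact: iter_stable.
rewrite (le_trans (small _))// ler_wpM2r ?rnorm_ge0// ler_weXn2l//.
by rewrite ltnW// ltn_pmod.
Qed.

(** The power bound is pushed outwards from the radius 1 / c, where it is
trivial, by a ratio q which depends only on the lower bound d for the
resolvent on the disc of radius t. The bound at s, used on the circle of
radius s / q, gives a contraction for K^n at radius s q, provided that n+1
exceeds a multiple of 1 / d^2 and q^(2n) <= 2. *)
Theorem eigenvalue_free_quasinilpotent (t : R) : 0 < t -> power_bounded t.
Proof.
move=> t0; have [d d0 lowd] := resolvent_bounded_below t0.
(* With n >= 8 / d^2, the resolvent bound 2 / (d^2 (n+1)) is below 1/4, which
leaves room for q^(2n) <= 2. *)
pose n := (Num.truncn (8 / d ^+ 2)).+1.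
have nd : 8 <= d ^+ 2 * n%:R.
  rewrite mulrC -ler_pdivrMr ?exprn_gt0//; apply: ltW; exact: truncnS_gt.
have [q q1 qn] := exists_small_ratio R (n * 2).
have q0 : 0 < q by lra.
have step s : 0 < s -> s <= t -> power_bounded s -> power_bounded (s * q).
  move=> s0 st bs; apply: (power_bounded_of_contraction (n := n)) => //.
    by rewrite mulr_gt0.
  move=> x Ex.
  have sq0 : 0 < s / q by rewrite divr_gt0.
  have sqs : s / q <= t by rewrite ler_pdivrMr// (le_trans st)// ler_peMr; lra.
  have := @power_bound_of_resolvent_bound t d (s / q) q n x sq0 sqs q1 d0 lowd.
  rewrite divfK ?gt_eqF// => /(_ bs Ex) h.
  have sqE : (s * q) ^+ n = q ^+ (n * 2) * (s / q) ^+ n.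
    rewrite mulnC exprM -exprMn; congr (_ ^+ _).
    by field; rewrite gt_eqF.
  rewrite sqE -mulrA; set a := _ * rnorm (iter n K x) in h *.
  have a0 : 0 <= a by rewrite mulr_ge0 ?rnorm_ge0// exprn_ge0// ltW.
  have : q ^+ (n * 2) * a <= 2 * a by rewrite ler_wpM2r.
  have : 8 * a <= d ^+ 2 * n%:R * a by rewrite ler_wpM2r.
  have : 0 <= d ^+ 2 * a by rewrite mulr_ge0// sqr_ge0.
  by rewrite -natr1 in h; lra.
have [_ [c c0 Kc]] := bK.
have base : power_bounded c^-1.
  apply: (power_bounded_of_contraction (n := 1)) => //; first by rewrite invr_gt0.
  by move=> x _; rewrite expr1 mulrC ler_pdivrMr// mulrC Kc.
have grow k : exists s, [/\ 0 < s, power_bounded s & c^-1 * q ^+ k <= s \/ t <= s].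
  elim: k => [|k [s [s0 bs [ks|ts]]]].
  - by exists c^-1; split=> //; [rewrite invr_gt0|left; rewrite mulr1].
  - have [st|/ltW ts] := leP s t; last by exists s; split=> //; right.
    exists (s * q); split; [by rewrite mulr_gt0|exact: step|left].
    by rewrite exprSr mulrA ler_pM2r.
  - by exists s; split=> //; right.
have [k kt] := exponential_unbounded (c * t) q1.
have [s [s0 bs st]] := grow k; apply: (power_bounded_le (ltW t0) _ bs).
case: st => // ks; rewrite (le_trans _ ks)// mulrC ler_pdivlMr//.
by rewrite mulrC.
Qed.

End Quasinilpotence.

(** * Polynomials of an operator *)

Section PolynomialCalculus.
Variables (R : realType) (H : completeNormedModType R[i]).
Implicit Types (E V : set H) (S T K Q : H -> H) (x y z w : H) (p q : {poly R[i]}).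

Lemma poly_operatorE n p T x : (size p <= n)%N ->
  poly_operator p T x = \sum_(k < n) p`_k *: iter k T x.
Proof.
move=> pn; rewrite /poly_operator (big_ord_widen _ (fun k => p`_k *: iter k T x) pn).
rewrite big_mkcond/=; apply: eq_bigr => k _; case: ltnP => // pk.
by rewrite nth_default// scale0r.
Qed.

Lemma poly_operatorB p q T x :
  poly_operator (p - q) T x = poly_operator p T x - poly_operator q T x.
Proof.
pose n := maxn (size (p - q)) (maxn (size p) (size q)).
rewrite !(@poly_operatorE n) /n ?leq_max ?leqnn ?orbT// -sumrB.
by apply: eq_bigr => k _; rewrite coefB scalerBl.
Qed.

Lemma poly_operatorC (a : R[i]) T x : poly_operator a%:P T x = a *: x.
Proof.
by rewrite (@poly_operatorE 1) ?size_polyC ?leq_b1// big_ord1 coefC.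
Qed.

Lemma poly_operatorMX p T x : poly_operator (p * 'X) T x = poly_operator p T (T x).
Proof.
rewrite (@poly_operatorE (size p).+1) ?(leq_trans (size_polyMleq _ _))//; last first.
  by rewrite size_polyX addn2.
rewrite big_ord_recl coefMX/= scale0r add0r; apply: eq_bigr => k _.
by rewrite coefMX/= -iterSr.
Qed.

Lemma poly_operatorMC p (a : R[i]) T x :
  poly_operator (p * a%:P) T x = a *: poly_operator p T x.
Proof.
rewrite (@poly_operatorE (size p)); last first.
  by rewrite mulrC mul_polyC size_scale_leq.
by rewrite scaler_sumr; apply: eq_bigr => k _; rewrite coefMC mulrC scalerA.
Qed.

Lemma bounded_linear_poly p T : bounded_linear T -> bounded_linear (poly_operator p T).
Proof.
move=> bT; rewrite /poly_operator; move: (size p) => n; elim: n => [|n IH].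
  rewrite (_ : (fun _ => _) = fun _ => 0); first exact: bounded_linear_0.
  by apply/funext => x; rewrite big_ord0.
rewrite (_ : (fun _ => _) = fun x => p`_n *: iter n T x + \sum_(k < n) p`_k *: iter k T x).
  by apply: bounded_linear_lin IH; exact: bounded_linear_iter.
by apply/funext => x; rewrite big_ord_recr/= addrC.
Qed.

Lemma poly_operator_sub p T E x : linear_subspace E ->
  (forall x, E x -> E (T x)) -> E x -> E (poly_operator p T x).
Proof.
move=> sE TE Ex; have itE k : E (iter k T x) by elim: k => //= k; exact: TE.
rewrite /poly_operator; elim/big_rec : _ => [|k y _ Ey]; first by case: sE.
by apply: subspaceD => //; exact: subspaceZ.
Qed.

(** With V = E and T' = T this says that a map commuting with T commutes with
p(T); with Q a quotient map it computes p of the induced operator. *)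
Lemma poly_operator_intertwine V Q T T' p x : bounded_linear Q ->
  (forall x, V x -> V (T x)) -> (forall x, V x -> Q (T x) = T' (Q x)) ->
  V x -> Q (poly_operator p T x) = poly_operator p T' (Q x).
Proof.
move=> bQ TV QT Vx; rewrite /poly_operator (bl_sum bQ); apply: eq_bigr => k _.
rewrite (blZ bQ); congr (_ *: _).
suff [_ ->] : V (iter k T x) /\ Q (iter k T x) = iter k T' (Q x) by [].
by elim: (nat_of_ord k) => //= m [Vm <-]; split; [exact: TV|exact: QT].
Qed.

(** Split off a root a of q, as q = q1 (X - a). Either (T - a) x = 0, or (T -
a) x is a nonzero vector killed by q1(T). *)
Lemma eigenvector_of_annihilating_polynomial E T q x :
  bounded_linear T -> linear_subspace E -> (forall x, E x -> E (T x)) ->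
  q != 0 -> E x -> x != 0 -> poly_operator q T x = 0 ->
  exists a y, [/\ E y, y != 0 & T y = a *: y].
Proof.
move=> bT sE TE; have [n] := ubnP (size q).
elim: n q x => // n IH q x qn q0 Ex x0 qx.
have [/eqP/size_poly1P[c c0 qc]|/closed_rootP[a]] := eqVneq (size q) 1%N.
  by move: qx; rewrite qc poly_operatorC => /eqP; rewrite scaler_eq0 (negPf c0) (negPf x0).
move/factor_theorem => [q1 qE].
have q10 : q1 != 0 by apply: contra_neq q0; rewrite qE => ->; rewrite mul0r.
have [Txa|Txa] := eqVneq (T x - a *: x) 0.
  by exists a, x; split=> //; apply/eqP; rewrite -subr_eq0 Txa.
apply: (IH q1 (T x - a *: x)) => //.
- by move: qn; rewrite qE size_Mmonic ?monicXsubC// size_XsubC addn2.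
- by apply: subspaceB => //; [exact: TE|exact: subspaceZ].
- have bq := bounded_linear_poly q1 bT.
  by rewrite (blB bq) (blZ bq) -poly_operatorMX -poly_operatorMC -poly_operatorB
    -mulrBr -qE.
Qed.

(** Constant polynomials are ruled out, so that p - a remains nonzero for
every scalar a. *)
Definition polynomially_compact_on E T :=
  exists2 p : {poly R[i]}, (1 < size p)%N & compact_on E (poly_operator p T).

(** Multiplying p by X makes it nonconstant, and p(T) T is still compact. *)
Lemma polynomially_compact_onT E T : bounded_linear T ->
  polynomially_compact T -> polynomially_compact_on E T.
Proof.
move=> bT [p p0 cp]; exists (p * 'X).
  by rewrite size_mulX// ltnS lt0n size_poly_eq0.
have bp := bounded_linear_poly p bT.
have cP := compact_operator_compact_on (E := setT) bp cp.
move=> r x _ xr; have [_ [c c0 Tc]] := bT.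
have [//|n|w wP] := cP (c * r) (T \o x).
  by rewrite (le_trans (Tc _))// ler_pM2l.
by exists w => e N e0; have [n Nn nw] := wP e N e0; exists n => //; rewrite poly_operatorMX.
Qed.

Lemma eigenvector_of_poly_eigenvector E T p :
  bounded_linear T -> linear_subspace E -> (forall x, E x -> E (T x)) ->
  (1 < size p)%N -> ~ eigenvalue_free E (poly_operator p T) ->
  exists a y, [/\ E y, y != 0 & T y = a *: y].
Proof.
move=> bT sE TE p1 /existsNP[a] /existsNP[x] /not_implyP[Ex] /not_implyP[px x0].
apply: (eigenvector_of_annihilating_polynomial (q := p - a%:P) (x := x)) => //.
- apply: contraTneq p1 => /eqP; rewrite subr_eq0 => /eqP ->.
  by rewrite -leqNgt size_polyC leq_b1.
- exact/eqP.
- by rewrite poly_operatorB poly_operatorC px subrr.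
Qed.

End PolynomialCalculus.

(** * Hyperinvariant subspaces *)

Section Hyperinvariant.
Variables (R : realType) (H : completeNormedModType R[i]).
Variables (dot : {dot H for Num.conj}) (hdot : hilbert_inner_product dot).
Implicit Types (E L : set H) (S T K : H -> H) (x y w : H).

Lemma closed_subspace_adherent (V : set H) :
  linear_subspace V -> closed_subspace [set x | adherent V x].
Proof.
move=> sV; apply/closed_subspace_adherentP; split; first split.
- by move=> e e0; exists 0; [case: sV|rewrite subrr rnorm0].
- move=> a x y Vx Vy e e0.
  have a1 : 0 < rnorm a + 1 by rewrite ltr_wpDl// rnorm_ge0.
  have [|x' Vx' xx] := Vx (e / 2 / (rnorm a + 1)); first by rewrite !divr_gt0.
  have [|y' Vy' yy] := Vy (e / 2); first by rewrite divr_gt0.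
  exists (a *: x' + y'); first by apply: sV.2.
  rewrite opprD addrACA -scalerBr (le_lt_trans (rnormD _ _))// rnormZ.
  have : rnorm a * rnorm (x - x') <= e / 2.
    rewrite (le_trans (y := (rnorm a + 1) * rnorm (x - x')))//.
      by rewrite ler_wpM2r ?rnorm_ge0// lerDl.
    by rewrite mulrC -ler_pdivlMr// ltW.
  by lra.
- move=> x xV e e0; have e2 : 0 < e / 2 by rewrite divr_gt0.
  have [y /(_ _ e2)[z Vz yz] xy] := xV _ e2.
  by exists z => //; have := rnormB x y z; lra.
Qed.

Definition nontrivial_in E L :=
  [/\ closed_subspace L, L `<=` E, exists2 y, L y & y != 0 & exists2 y, E y & ~ L y].

(** The candidates S range over the commutant of T on E; a subspace stable
under all of them is hyperinvariant. *)
Definition commuting_on E T S :=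
  [/\ bounded_linear S, forall x, E x -> E (S x) & forall x, E x -> S (T x) = T (S x)].

(** Hilden's proof of Lomonosov's theorem. If no orbit closure of the
commutant is a proper subspace, every nonzero vector of E can be moved by the
commutant into the ball U around x0. By compactness of K a single norm bound b
suffices for moving all of K U back into U. Applying K and moving back n times
gives a vector of U of the form T K^n x0 with |T| <= b^n, whose norm tends to
0 by quasinilpotence; but U stays away from 0. *)
Lemma hyperinvariant_of_quasinilpotent_compact E K x0 :
  closed_subspace E -> bounded_linear K ->
  (forall x, E x -> E (K x)) -> compact_on E K ->
  (forall t, 0 < t -> power_bounded E K t) -> E x0 -> K x0 != 0 ->
  exists2 L, nontrivial_in E L &
    forall S, commuting_on E K S -> forall x, L x -> L (S x).
Proof.
move=> cE bK KE cK qK Ex0 Kx0; have sE := closed_subspace_sub cE.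
pose orb y := [set S y | S in commuting_on E K].
have sorb y : E y -> linear_subspace (orb y).
  move=> Ey; split.
    exists (fun _ => 0) => //; split=> [|x _|x _]; first exact: bounded_linear_0.
      by case: sE.
    by rewrite (bl0 bK).
  move=> a _ _ [S [bS SE SK] <-] [S' [bS' SE' SK'] <-].
  exists (fun x => a *: S x + S' x) => //; split=> [|x Ex|x Ex].
  - exact: bounded_linear_lin.
  - by apply: sE.2; [exact: SE|exact: SE'].
  - by rewrite (blP bK) SK// SK'.
apply: contrapT => noL.
have dense y x (e : R) : E y -> y != 0 -> E x -> 0 < e ->
    exists2 S, commuting_on E K S & rnorm (x - S y) < e.
  move=> Ey y0 Ex e0.
  have : adherent (orb y) x.
    apply: contrapT => nx; apply: noL; exists [set x | adherent (orb y) x].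
      split; first by apply: closed_subspace_adherent; exact: sorb.
      - move=> z zO; apply: (closed_subspace_adh cE) => d d0.
        by have [_ [S [_ SE _] <-] zS] := zO d d0; exists (S y) => //; exact: SE.
      - exists y => // d d0; exists y; last by rewrite subrr rnorm0.
        by exists (fun x => x) => //; split=> //; exact: bounded_linear_id.
      - by exists x.
    move=> S [bS SE SK] z zO d d0; have [_ [s s0 Ss]] := bS.
    have [|_ [S' [bS' SE' SK'] <-] zS] := zO (d / s); first by rewrite divr_gt0.
    exists (S (S' y)).
      exists (fun x => S (S' x)) => //; split=> [|v Ev|v Ev].
      - exact: bounded_linear_comp.
      - exact/SE/SE'.
      - by rewrite SK'// SK//; exact: SE'.
    by rewrite -(blB bS) (le_lt_trans (Ss _))// mulrC -ltr_pdivlMr.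
  by move=> /(_ e e0)[_ [S SC <-] xS]; exists S.
have [_ [c c0 Kc]] := bK; have k0 := rnorm_gt0 Kx0.
(* This radius keeps U at distance rho from 0 and K U at distance |K x0| / 2
from 0, so a cluster point of K U is nonzero. *)
pose rho := rnorm (K x0) / (2 * c).
have rho0 : 0 < rho by rewrite divr_gt0// mulr_gt0.
have crho : c * rho = rnorm (K x0) / 2 by rewrite /rho; field; rewrite gt_eqF.
pose U x := E x /\ rnorm (x - x0) < rho.
pose bounded_by (b : R) S := forall v, rnorm (S v) <= b * rnorm v.
have [b b0 bP] : exists2 b : R, 0 < b & forall x, U x ->
    exists S, [/\ commuting_on E K S, bounded_by b S & U (S (K x))].
  apply: contrapT => nb.
  have /choice[x xP] (n : nat) : exists x, U x /\
      forall S, commuting_on E K S -> bounded_by n.+1%:R S -> ~ U (S (K x)).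
    apply: contrapT => nx; apply: nb; exists n.+1%:R => // x Ux.
    apply: contrapT => nS; apply: nx; exists x; split=> // S SC Sb US.
    by apply: nS; exists S.
  have [||w wP] := cK (rnorm x0 + rho) x.
  - by move=> n; case: (xP n) => -[].
  - move=> n; have [[_ xn] _] := xP n.
    by have := rnormD (x n - x0) x0; rewrite subrK; lra.
  have Ew : E w.
    apply: (closed_subspace_adh cE) => e e0; have [n _ nw] := wP e 0%N e0.
    by exists (K (x n)); [apply: KE; case: (xP n) => -[]|rewrite rnormC].
  have w0 : w != 0.
    apply/negP => /eqP w0; have k2 : 0 < rnorm (K x0) / 2 by rewrite divr_gt0.
    have [n _] := wP _ 0%N k2; rewrite w0 subr0.
    have [[_ xn] _] := xP n; have := rnormD (K (x0 - x n)) (K (x n)).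
    rewrite -(blD bK) subrK; have := Kc (x0 - x n).
    have : c * rnorm (x0 - x n) <= c * rho by rewrite ler_pM2l// rnormC ltW.
    by lra.
  have r2 : 0 < rho / 2 by rewrite divr_gt0.
  have [S SC Sw] := dense w x0 _ Ew w0 Ex0 r2.
  have [bS SE SK] := SC; have [_ [s s0 Ss]] := bS.
  have [n Nn nw] := wP (rho / 2 / s) (Num.truncn s) (divr_gt0 r2 s0).
  have [[Exn xn] /(_ S SC)] := xP n; apply.
    move=> v; rewrite (le_trans (Ss v))// ler_wpM2r ?rnorm_ge0// ltW//.
    by rewrite (lt_le_trans (truncnS_gt s))// ler_nat ltnS.
  split; first exact/SE/KE.
  have : rnorm (S (K (x n) - w)) < rho / 2.
    by rewrite (le_lt_trans (Ss _))// mulrC -ltr_pdivlMr.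
  rewrite (blB bS); have := rnormB (S (K (x n))) (S w) x0.
  by rewrite (rnormC (S w)); lra.
have iterate n : exists T, [/\ commuting_on E K T, bounded_by (b ^+ n) T &
    U (T (iter n K x0))].
  elim: n => [|n [T [[bT TE TK] Tb UT]]].
    exists (fun x => x); split; last by split=> //; rewrite subrr rnorm0.
      by split=> //; exact: bounded_linear_id.
    by move=> v; rewrite mul1r.
  have [S [[bS SE SK] Sb US]] := bP _ UT; exists (fun x => S (T x)); split.
  - split=> [|v Ev|v Ev]; first exact: bounded_linear_comp.
      exact/SE/TE.
    by rewrite TK// SK//; exact: TE.
  - by move=> v; rewrite (le_trans (Sb _))// exprS -mulrA ler_pM2l.
  - by rewrite /= TK//; exact: (iter_stable KE).
have x0rho : 2 * rho <= rnorm x0.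
  by rewrite -(ler_pM2l c0); have := Kc x0; lra.
have [C C0 Cb] := qK (2 * b) (mulr_gt0 (ltr0Sn R 1) b0).
have gt1_2 : 1 < 2 :> R by rewrite ltr1n.
have [n nP] := exponential_unbounded (C * rnorm x0 / rho + 1) gt1_2.
have [T [_ Tb [_ TU]]] := iterate n.
have lower : rho <= b ^+ n * rnorm (iter n K x0).
  have := Tb (iter n K x0); have := rnormB x0 (T (iter n K x0)) 0.
  by rewrite !subr0 (rnormC x0); lra.
have := Cb n x0 Ex0; rewrite exprMn -mulrA => upper.
have : 2 ^+ n * rho <= C * rnorm x0.
  by rewrite (le_trans _ upper)// ler_pM2l// exprn_gt0.
rewrite -ler_pdivlMr//; lra.
Qed.

(** Either p(T) has an eigenvector, and then an eigenspace of T is proper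
because T is not scalar, or p(T) is quasinilpotent and nonzero. *)
Theorem hyperinvariant_subspace E T : closed_subspace E -> bounded_linear T ->
  (forall x, E x -> E (T x)) -> polynomially_compact_on E T ->
  ~ (exists a : R[i], forall x, E x -> T x = a *: x) ->
  exists2 L, nontrivial_in E L &
    forall S, commuting_on E T S -> forall x, L x -> L (S x).
Proof.
move=> cE bT TE [p p1 cp] nonscalar; have sE := closed_subspace_sub cE.
have bp := bounded_linear_poly p bT.
have [free|/(eigenvector_of_poly_eigenvector bT sE TE p1)[a [y [Ey y0 Ty]]]] :=
    pselect (eigenvalue_free E (poly_operator p T)).
  have [x Ex x0] : exists2 x, E x & x != 0.
    apply: contrapT => nx; apply: nonscalar; exists 0 => x Ex.
    have [->|x0] := eqVneq x 0; first by rewrite (bl0 bT) scale0r.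
    by case: nx; exists x.
  have pE z : E z -> E (poly_operator p T z) by exact: poly_operator_sub.
  have px0 : poly_operator p T x != 0.
    by apply: contra_neq x0 => px; apply: (free 0) => //; rewrite scale0r.
  have qn t := eigenvalue_free_quasinilpotent hdot cE bp pE cp free (t := t).
  have [L LE Lhyp] := hyperinvariant_of_quasinilpotent_compact cE bp pE cp qn Ex px0.
  exists L => // S [bS SE ST]; apply: Lhyp; split=> // z Ez.
  exact: (poly_operator_intertwine (V := E)).
exists (E `&` [set x | T x = a *: x]).
  split; last 2 first.
  - by exists y.
  - apply: contrapT => nL; apply: nonscalar; exists a => x Ex.
    by apply: contrapT => Tx; apply: nL; exists x => // -[].
  - by apply: closed_subspaceI => //; exact: closed_subspace_eigenspace.
  - by move=> x [].
move=> S [bS SE ST] x [Ex /= Tx]; split; first exact: SE.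
by rewrite /= -ST// Tx (blZ bS).
Qed.

(** The subspace F answers the case where both operators are scalar on E, in
which every subspace is invariant. *)
Lemma common_invariant_subspace E F A B : closed_subspace E ->
  bounded_linear A -> bounded_linear B ->
  (forall x, E x -> E (A x)) -> (forall x, E x -> E (B x)) ->
  (forall x, E x -> A (B x) = B (A x)) ->
  polynomially_compact_on E A -> polynomially_compact_on E B ->
  nontrivial_in E F ->
  exists2 L, nontrivial_in E L & forall x, L x -> L (A x) /\ L (B x).
Proof.
move=> cE bA bB AE BE AB pA pB ntF.
have [[a Aa]|nA] := pselect (exists a : R[i], forall x, E x -> A x = a *: x); last first.
  have [L ntL hyp] := hyperinvariant_subspace cE bA AE pA nA.
  by exists L => // x Lx; split; apply: hyp => //; split=> // y Ey; rewrite AB.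
have [[b Bb]|nB] := pselect (exists b : R[i], forall x, E x -> B x = b *: x); last first.
  have [L ntL hyp] := hyperinvariant_subspace cE bB BE pB nB.
  by exists L => // x Lx; split; apply: hyp => //; split.
exists F => // x Fx; have [cF FE _ _] := ntF.
have sF := closed_subspace_sub cF.
by rewrite Aa ?Bb; [split; exact: subspaceZ|exact: FE..].
Qed.

End Hyperinvariant.

(** * Eigenvectors of normal operators *)

Section Normal.
Variables (R : realType) (H : completeNormedModType R[i]).
Variables (dot : {dot H for Num.conj}) (hdot : hilbert_inner_product dot).
Implicit Types (E L : set H) (S T K : H -> H) (x y w : H).

Lemma normal_rnorm T S : adjoint_of dot T S -> (forall x, T (S x) = S (T x)) ->
  forall x, rnorm (S x) = rnorm (T x).
Proof.
move=> adj TS x; apply/eqP; rewrite -(eqrXn2 (n := 2)) ?rnorm_ge0//; apply/eqP.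
apply: complexI; rewrite -!(dotxx hdot) -adj TS (dotC _ (S (T x))) -adj.
by rewrite -dotC.
Qed.

Lemma adjoint_poly T S p : adjoint_of dot T S -> bounded_linear S ->
  adjoint_of dot (poly_operator p T) (poly_operator (map_poly Num.conj p) S).
Proof.
move=> adj bS x y.
have itadj k u v : dot (iter k T u) v = dot u (iter k S v).
  by elim: k u v => //= k IH u v; rewrite adj IH -iterSr.
rewrite (@poly_operatorE _ _ (size p) (map_poly _ _)) ?size_map_poly//.
rewrite /poly_operator; elim/big_ind2 : _ => [|u u' v v' uv uv'|k _].
- by rewrite dot0l (dotC _ x) dot0l rmorph0.
- by rewrite dotDl dotDr uv uv'.
- by rewrite dotZl dotZr itadj coef_map/= conjCK.
Qed.

(** If K = p(T) had no eigenvector in E it would be quasinilpotent there. But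
|Ky|^2 = (y, K'Ky) <= |y| |K'Ky| = |y| |K^2 y| for the adjoint K' of K, so the
ratios |K^(n+1) x| / |K^n x| are nondecreasing in n and |K^n x| decays at most
geometrically. *)
Theorem normal_invariant_eigenvector T S E : closed_subspace E ->
  bounded_linear T -> bounded_linear S -> adjoint_of dot T S ->
  (forall x, T (S x) = S (T x)) -> (forall x, E x -> E (T x)) ->
  polynomially_compact_on E T -> (exists2 x, E x & x != 0) ->
  exists a y, [/\ E y, y != 0 & T y = a *: y].
Proof.
move=> cE bT bS adj TS TE [p p1 cp] [x Ex x0]; have sE := closed_subspace_sub cE.
have bp := bounded_linear_poly p bT.
apply: (eigenvector_of_poly_eigenvector bT sE TE p1) => free.
pose K := poly_operator p T; pose K' := poly_operator (map_poly Num.conj p) S.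
have adjK : adjoint_of dot K K' by exact: adjoint_poly.
have KS y : K (S y) = S (K y).
  by rewrite /K (poly_operator_intertwine (V := setT) (T' := T)).
have KK y : K (K' y) = K' (K y).
  by rewrite /K' (poly_operator_intertwine (V := setT) (T' := S)).
have logconvex y : rnorm (K y) ^+ 2 <= rnorm y * rnorm (K (K y)).
  have := cauchy_schwarz hdot y (K' (K y)).
  rewrite -adjK (normal_rnorm adjK KK) (dotxx hdot) rnorm_real//.
  exact: sqr_ge0.
have KE y : E y -> E (K y) by exact: poly_operator_sub.
have Kx0 : K x != 0.
  by apply: contra_neq x0 => Kx; apply: (free 0) => //; rewrite scale0r.
have n0 := rnorm_gt0 x0; pose r := rnorm (K x) / rnorm x.
have r0 : 0 < r by rewrite divr_gt0// rnorm_gt0.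
have growth n : 0 < rnorm (iter n K x) /\
    r * rnorm (iter n K x) <= rnorm (iter n.+1 K x).
  elim: n => [|n [an0 IH]]; first by split=> //=; rewrite divfK// gt_eqF.
  have an1 : 0 < rnorm (iter n.+1 K x) by rewrite (lt_le_trans _ IH)// mulr_gt0.
  split=> //; rewrite -(ler_pM2l an0) (le_trans _ (logconvex (iter n K x)))//.
  by rewrite mulrA (mulrC _ r) expr2 ler_pM2r.
have geometric n : r ^+ n * rnorm x <= rnorm (iter n K x).
  elim: n => [|n IH]; first by rewrite mul1r.
  have [_ h] := growth n; rewrite (le_trans _ h)// exprS -mulrA ler_pM2l//.
have [C _ Cb] := eigenvalue_free_quasinilpotent hdot cE bp KE cp free
  (divr_gt0 (ltr0Sn R 1) r0).
have gt1_2 : 1 < 2 :> R by rewrite ltr1n.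
have [n nP] := exponential_unbounded (C + 1) gt1_2.
have := Cb n x Ex; apply/negP; rewrite -ltNge.
rewrite (lt_le_trans (y := (2 / r) ^+ n * (r ^+ n * rnorm x)))//; last first.
  by rewrite ler_pM2l ?geometric// exprn_gt0// divr_gt0.
rewrite mulrA -exprMn divfK ?gt_eqF// ltr_pM2r//; lra.
Qed.

End Normal.

(** * Maximal chains of invariant subspaces *)

Section Triangularization.
Variables (R : realType) (H : completeNormedModType R[i]).
Variables (dot : {dot H for Num.conj}) (hdot : hilbert_inner_product dot).
Variables (A B : H -> H) (M : set H).
Hypotheses (bA : bounded_linear A) (bB : bounded_linear B).
Hypotheses (pcA : polynomially_compact A) (pcB : polynomially_compact B).
Hypotheses (cM : closed_subspace M) (AM : forall x, M x -> M (A x)).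
Hypotheses (BM : forall x, M (B x)) (AB : forall x, M x -> A (B x) = B (A x)).
Implicit Types (V W X L : set H) (C D : set (set H)) (x y : H).

Definition common_invariant V :=
  [/\ closed_subspace V, invariant_under A V & invariant_under B V].

Lemma common_invariant_bigcap C :
  C `<=` common_invariant -> common_invariant (\bigcap_(V in C) V).
Proof.
move=> CI; split.
- by apply: closed_subspace_bigcap => V /CI[].
- by move=> x Vx V CV; have [_ AV _] := CI V CV; exact: (AV x (Vx V CV)).
- by move=> x Vx V CV; have [_ _ BV] := CI V CV; exact: (BV x (Vx V CV)).
Qed.

Lemma common_invariant_span C : C `<=` common_invariant ->
  common_invariant (closed_span (\bigcup_(V in C) V)).
Proof.
move=> CI; have cS := closed_subspace_span (\bigcup_(V in C) V).
split=> //.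
- apply: (closed_span_sub (closed_subspace_preim bA cS)) => x [V CV Vx].
  by apply: sub_closed_span; exists V => //; have [_ AV _] := CI V CV; exact: AV.
- apply: (closed_span_sub (closed_subspace_preim bB cS)) => x [V CV Vx].
  by apply: sub_closed_span; exists V => //; have [_ _ BV] := CI V CV; exact: BV.
Qed.

(** On E, the orthogonal complement of Vm in Vp, the compressions QA and QB
represent A and B modulo Vm. They commute on E under either alternative on M.
A nontrivial subspace of E invariant under both is pulled back along Q; V only
serves to show that E has dimension at least 2. *)
Lemma common_invariant_gap Vm Vp V :
  common_invariant Vm -> common_invariant Vp -> closed_subspace V ->
  Vm `<=` V -> V `<=` Vp -> ~ (V `<=` Vm) -> ~ (Vp `<=` V) ->
  M `<=` Vm \/ Vp `<=` M ->
  exists L, [/\ common_invariant L, Vm `<=` L, L `<=` Vp, ~ (L `<=` Vm) & ~ (Vp `<=` L)].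
Proof.
move=> [cm Am Bm] [cp Ap Bp] cV mV VVp nVm npV cmpM.
have [Q [bQ mQ oQ]] := orthogonal_complement_decomposition hdot cm.
have [[sV sp] sm] := (closed_subspace_sub cV, closed_subspace_sub cp, closed_subspace_sub cm).
have so := closed_subspace_sub (closed_subspace_orthogonal hdot Vm).
have Q0 x : Vm x -> Q x = 0.
  move=> Vx; apply: (orthogonal_self hdot (X := Vm)) => //.
  by rewrite -[Q x](subKr x); apply: subspaceB => //; exact: mQ.
have Qid x : orthogonal_set dot Vm x -> Q x = x.
  move=> ox; apply/esym/eqP; rewrite -subr_eq0; apply/eqP.
  apply: (orthogonal_self hdot (mQ x)); apply: (subspaceB so) => //; exact: oQ.
have QA x : Q (A x) = Q (A (Q x)).
  apply/eqP; rewrite -subr_eq0 -(blB bQ) -(blB bA); apply/eqP/Q0/Am; exact: mQ.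
have QB x : Q (B x) = Q (B (Q x)).
  apply/eqP; rewrite -subr_eq0 -(blB bQ) -(blB bB); apply/eqP/Q0/Bm; exact: mQ.
have Q_in W x : closed_subspace W -> Vm `<=` W -> W x -> W (Q x).
  move=> /closed_subspace_sub sW mW Wx; rewrite -[Q x](subKr x).
  by apply: subspaceB => //; exact: (mW _ (mQ x)).
have mVp : Vm `<=` Vp by move=> x /mV /VVp.
pose E := Vp `&` orthogonal_set dot Vm; pose F := V `&` orthogonal_set dot Vm.
have cE : closed_subspace E by apply: closed_subspaceI => //; exact: closed_subspace_orthogonal.
have QE x : Vp x -> E (Q x) by move=> px; split=> //; exact: Q_in.
have bQA := bounded_linear_comp bQ bA; have bQB := bounded_linear_comp bQ bB.
have pc T : bounded_linear T -> polynomially_compact T ->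
    (forall x, Q (T x) = Q (T (Q x))) -> polynomially_compact_on E (fun x => Q (T x)).
  move=> bT /(polynomially_compact_onT E bT)[p p1 cpp] QT; exists p => //.
  apply: compact_on_ext (compact_on_comp bQ cpp) => x [_ /Qid Qx].
  rewrite (poly_operator_intertwine (V := setT) (T' := fun x => Q (T x))) ?Qx//.
have QAE x : E x -> E (Q (A x)) by move=> [px _]; exact: (QE _ (Ap _ px)).
have QBE x : E x -> E (Q (B x)) by move=> [px _]; exact: (QE _ (Bp _ px)).
have QAB x : E x -> Q (A (Q (B x))) = Q (B (Q (A x))).
  move=> [px _]; rewrite -QA -QB; case: cmpM => [Mm|pM].
    by rewrite (QA (B x)) !(Q0 (B _)) ?(bl0 bA) ?(bl0 bQ)//; exact: (Mm _ (BM _)).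
  by rewrite AB//; exact: pM.
have ntF : nontrivial_in E F.
  split.
  - by apply: closed_subspaceI => //; exact: closed_subspace_orthogonal.
  - by move=> x [Vx ox]; split=> //; exact: VVp.
  - apply: contrapT => nF; apply: nVm => x Vx; rewrite -[x](subrK (Q x)).
    have [Qx|Qx] := eqVneq (Q x) 0; first by have := mQ x; rewrite Qx addr0.
    by case: nF; exists (Q x) => //; split=> //; exact: Q_in.
  - apply: contrapT => nF; apply: npV => x px; rewrite -[x](subrK (Q x)).
    apply: (subspaceD sV); first exact: (mV _ (mQ x)).
    by apply: contrapT => nV; apply: nF; exists (Q x); [exact: QE|case].
have [L [cL LE [y Ly y0] [z Ez nLz]] invL] := common_invariant_subspace hdot
  cE bQA bQB QAE QBE QAB (pc A bA pcA QA) (pc B bB pcB QB) ntF.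
exists (Vp `&` [set x | L (Q x)]); split.
- split; first by apply: closed_subspaceI => //; exact: closed_subspace_preim.
    by move=> x [px /= Lx]; split; [exact: Ap|rewrite /= QA; case: (invL _ Lx)].
  by move=> x [px /= Lx]; split; [exact: Bp|rewrite /= QB; case: (invL _ Lx)].
- by move=> x mx; split; [exact: mVp|rewrite /= Q0//; case: cL].
- by move=> x [].
- move=> Lm; case/eqP: y0; have [py oy] := LE y Ly.
  apply: (orthogonal_self hdot (X := Vm)) (oy).
  by apply: Lm; split=> //=; rewrite Qid.
- by move=> pL; apply: nLz; have [pz oz] := Ez; have [_ /=] := pL z pz; rewrite Qid.
Qed.

(** Requiring comparability with M, instead of membership of M, keeps the
empty chain admissible in Zorn's lemma; maximality then puts M into the chain.
*)
Theorem triangularizable_of_flag : simultaneously_triangularizable A B.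
Proof.
pose P C := [/\ C `<=` common_invariant, total_on C subset &
  forall V, C V -> V `<=` M \/ M `<=` V].
have [C [[CI tC CM] maxC]] : exists C, P C /\ forall D, C `<` D -> ~ P D.
  apply: Zorn_bigcup => F FP tF; split.
  - by move=> V [C FC CV]; have [CI _ _] := FP C FC; exact: CI.
  - move=> V W [C FC CV] [D FD DW].
    have [_ tC _] := FP C FC; have [_ tD _] := FP D FD.
    by case: (tF C D FC FD) => CD; [apply: tD|apply: tC] => //; exact: CD.
  - by move=> V [C FC CV]; have [_ _ CM] := FP C FC; exact: CM.
(* By maximality, C contains every common invariant subspace with which it can
be extended. *)
have absorb V : common_invariant V -> (forall X, C X -> V `<=` X \/ X `<=` V) ->
    V `<=` M \/ M `<=` V -> C V.
  move=> IV VC VM; apply: contrapT => nCV; apply: (maxC (C `|` [set V])).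
    by split=> [X CX|/(_ V)]; [left|move=> h; apply/nCV/h; right].
  split.
  - by move=> X [/CI|->].
  - move=> X Y [CX|->] [CY|->]; [exact: tC| | exact: VC |by left].
    by case: (VC X CX); [right|left].
  - by move=> X [/CM|->].
have CMM : C M.
  apply: absorb; last by left.
    by split=> // x _.
  by move=> X /CM[]; [right|left].
have absorbC V : common_invariant V -> (forall X, C X -> V `<=` X \/ X `<=` V) -> C V.
  by move=> IV VC; apply: absorb => //; exact: VC.
exists C; last by move=> V /CI[].
split; first by split=> // V /CI[].
move=> D [DS tD] CD; apply/seteqP; split=> // V DV.
have cV := DS V DV.
have VC X : C X -> V `<=` X \/ X `<=` V by move=> /CD; exact: tD.
pose Cp := [set X | C X /\ V `<=` X]; pose Cm := [set X | C X /\ X `<=` V].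
(* Vm and Vp are the two ends of the gap of C that contains V. *)
pose Vp := \bigcap_(X in Cp) X; pose Vm := closed_span (\bigcup_(X in Cm) X).
have Ip : common_invariant Vp by apply: common_invariant_bigcap => X [/CI].
have Im : common_invariant Vm by apply: common_invariant_span => X [/CI].
have VVp : V `<=` Vp by move=> x Vx X [_]; exact.
have VmV : Vm `<=` V by apply: closed_span_sub => // x [X [_ XV] /XV].
have CVmVp X : C X -> X `<=` Vm \/ Vp `<=` X.
  move=> CX; case: (VC X CX) => [VX|XV]; [right|left].
    by move=> x; apply; split.
  by move=> x Xx; apply: sub_closed_span; exists X.
have VmVp : Vm `<=` Vp by move=> x /VmV /VVp.
have CVp : C Vp.
  apply: absorbC => // X /CVmVp[XVm|]; [right|by left].
  by move=> x /XVm /VmVp.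
have CVm : C Vm.
  apply: absorbC => // X /CVmVp[|VpX]; [by right|left].
  by move=> x /VmVp /VpX.
apply: contrapT => nCV.
have [|||L [IL mL Lp nLm npL]] := common_invariant_gap Im Ip cV VmV VVp.
- by move=> VVm; apply: nCV; have -> : V = Vm by apply/seteqP.
- by move=> VpV; apply: nCV; have -> : V = Vp by apply/seteqP.
- exact: CVmVp.
have : C L.
  apply: absorbC => // X /CVmVp[XVm|VpX]; [right|left] => x.
    by move=> /XVm /mL.
  by move=> /Lp /VpX.
by case/CVmVp.
Qed.

End Triangularization.

(** * The range of a normal operator *)

Section CommutatorKillsRange.
Variables (R : realType) (H : completeNormedModType R[i]).
Variables (dot : {dot H for Num.conj}) (hdot : hilbert_inner_product dot).
Variables (A B S : H -> H).
Hypotheses (bA : bounded_linear A) (bB : bounded_linear B) (bS : bounded_linear S).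
Hypotheses (adj : adjoint_of dot B S) (BS : forall x, B (S x) = S (B x)).
Hypothesis ABB : forall x, A (B (B x)) = B (A (B x)).
Implicit Types (x y : H).

(** This is the closure of the range of B when S is the adjoint of B. *)
Definition range_closure : set H := orthogonal_set dot [set y | S y = 0].
Local Notation M := range_closure.

Lemma closed_subspace_range_closure : closed_subspace M.
Proof. exact: closed_subspace_orthogonal. Qed.

Lemma range_closure_image x : M (B x).
Proof. by move=> y /= Sy; rewrite adj Sy (dotC _ x) dot0l rmorph0. Qed.

(** The part of x orthogonal to the range of B^2 is killed by S^2, hence by BS
as B and S have the same norms, hence by S. *)
Lemma range_closure_sub_span_square : M `<=` closed_span [set B (B x) | x in setT].
Proof.
set X := closed_span _ => x Mx.
have cX : closed_subspace X by exact: closed_subspace_span.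
have cM := closed_subspace_range_closure.
have XM : X `<=` M.
  by apply: closed_span_sub => // _ [y _ <-]; exact: range_closure_image.
have [Q [_ XQ oQ]] := orthogonal_complement_decomposition hdot cX.
have MQ : M (Q x).
  rewrite -[Q x](subKr x); apply: (subspaceB (closed_subspace_sub cM)) => //.
  exact: (XM _ (XQ x)).
have SSQ : S (S (Q x)) = 0.
  apply: (dotxx_eq0 hdot); rewrite -!adj dotC (oQ x) ?rmorph0//.
  by apply: sub_closed_span; exists (S (S (Q x))).
have BSQ : B (S (Q x)) = 0.
  by apply: rnorm_eq0; rewrite -(normal_rnorm hdot adj BS) SSQ rnorm0.
have SQ : S (Q x) = 0 by apply: (dotxx_eq0 hdot); rewrite -adj BSQ dot0l.
have Q0 : Q x = 0 by apply: (dotxx_eq0 hdot); exact: MQ.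
by have := XQ x; rewrite Q0 subr0.
Qed.

(** Both assertions define closed subspaces, so it is enough to check them on
the range of B^2, where they follow from AB^2 = BAB. *)
Lemma range_closure_invariant_commute x : M x -> M (A x) /\ A (B x) = B (A x).
Proof.
move=> /range_closure_sub_span_square; set X := [set B (B y) | y in setT] => Xx.
have bC := bounded_linear_lin (-1) (bounded_linear_comp bB bA) (bounded_linear_comp bA bB).
have cM := closed_subspace_range_closure.
have sub : closed_span X `<=`
    [set y | M (A y)] `&` [set y | -1 *: B (A y) + A (B y) = 0].
  apply: closed_span_sub.
    apply: closed_subspaceI; first exact: closed_subspace_preim.
    exact: (closed_subspace_ker bC).
  move=> _ [y _ <-]; split=> /=; first by rewrite ABB; exact: range_closure_image.
  by rewrite (ABB (B y)) scaleN1r addNr.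
have [MA /= C0] := sub x Xx; split=> //.
by apply/eqP; rewrite -subr_eq0 -C0 scaleN1r addrC.
Qed.

End CommutatorKillsRange.

(** * Common eigenvectors of two normal operators *)

Section Diagonalization.
Variables (R : realType) (H : completeNormedModType R[i]).
Variables (dot : {dot H for Num.conj}) (hdot : hilbert_inner_product dot).
Implicit Types (A B S T : H -> H) (x y : H).

(** The operator T - a is normal with adjoint S - conj a, and a normal
operator has the same kernel as its adjoint. *)
Lemma normal_adjoint_eigenvector T S (a : R[i]) x : 
  adjoint_of dot T S -> (forall x, T (S x) = S (T x)) ->
  bounded_linear T -> bounded_linear S ->
  T x = a *: x -> S x = Num.conj a *: x.
Proof.
move=> adj TS bT bS Tx.
pose T' y := - a *: y + T y; pose S' y := - Num.conj a *: y + S y.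
have adj' : adjoint_of dot T' S'.
  move=> y z; rewrite /T' /S' dotDl dotZl dotDr dotZr adj; congr (_ * _ + _).
  by rewrite rmorphN/= conjCK.
have TS' y : T' (S' y) = S' (T' y).
  rewrite /T' /S' !(blD bT, blD bS) !(blZ bT, blZ bS) TS !scalerDr !scalerA.
  by rewrite (mulrC (- a)) !addrA; congr (_ + _); rewrite addrAC.
have := normal_rnorm hdot adj' TS' x; rewrite /T' Tx scaleNr addNr rnorm0.
by move=> /rnorm_eq0; rewrite /S' scaleNr => /eqP; rewrite addrC subr_eq0 => /eqP.
Qed.

Lemma orthogonal_of_eigenvectors_invariant T S (X : set H) :
  adjoint_of dot T S -> (forall x, T (S x) = S (T x)) ->
  bounded_linear T -> bounded_linear S ->
  X `<=` eigenvector T -> invariant_under T (orthogonal_set dot X).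
Proof.
move=> adj TS bT bS XT x ox y Xy; have [_ [a Ty]] := XT y Xy.
by rewrite adj (normal_adjoint_eigenvector adj TS bT bS Ty) dotZr ox// mulr0.
Qed.

Lemma closed_span_setT (X : set H) :
  (forall x, orthogonal_set dot X x -> x = 0) -> closed_span X = setT.
Proof.
move=> oX; apply/seteqP; split=> // x _.
have [Q [_ XQ oQ]] := orthogonal_complement_decomposition hdot (closed_subspace_span X).
have Q0 : Q x = 0 by apply: oX => y Xy; apply: oQ; exact: sub_closed_span.
by have := XQ x; rewrite Q0 subr0.
Qed.

Lemma simultaneously_diagonalizable_commute A B :
  bounded_linear A -> bounded_linear B ->
  simultaneously_diagonalizable A B -> forall x, A (B x) = B (A x).
Proof.
move=> bA bB dAB x.
have bC := bounded_linear_lin (-1) (bounded_linear_comp bB bA) (bounded_linear_comp bA bB).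
have /(_ x) : closed_span [set x | eigenvector A x /\ eigenvector B x] `<=`
    [set y | -1 *: B (A y) + A (B y) = 0].
  apply: closed_span_sub; first exact: (closed_subspace_ker bC).
  move=> y [[_ [a Ay]] [_ [b By]]] /=.
  by rewrite scaleN1r Ay By (blZ bA) (blZ bB) Ay By !scalerA mulrC addNr.
rewrite dAB /= => /(_ I) C0.
by apply/eqP; rewrite -subr_eq0 -C0 scaleN1r addrC.
Qed.

(** A nonzero common invariant subspace orthogonal to all common eigenvectors
would contain one: inside M because the eigenspaces of B there are invariant
under A, and when M meets it trivially because B vanishes on it. *)
Lemma normal_pair_diagonalizable A B SA SB (M : set H) :
  bounded_linear A -> bounded_linear SA -> adjoint_of dot A SA ->
  (forall x, A (SA x) = SA (A x)) -> polynomially_compact A ->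
  bounded_linear B -> bounded_linear SB -> adjoint_of dot B SB ->
  (forall x, B (SB x) = SB (B x)) -> polynomially_compact B ->
  closed_subspace M -> (forall x, M x -> M (A x)) -> (forall x, M (B x)) ->
  (forall x, M x -> A (B x) = B (A x)) ->
  simultaneously_diagonalizable A B.
Proof.
move=> bA bSA adjA ASA pcA bB bSB adjB BSB pcB cM AM BM AB.
apply: closed_span_setT => x; set X := [set _ | _] => ox; apply: contrapT => /eqP x0.
pose G := orthogonal_set dot X.
have cG : closed_subspace G by exact: closed_subspace_orthogonal.
have AG : invariant_under A G.
  by apply: (orthogonal_of_eigenvectors_invariant adjA ASA bA bSA) => y [].
have BG : invariant_under B G.
  by apply: (orthogonal_of_eigenvectors_invariant adjB BSB bB bSB) => y [].
have noG a b y : G y -> y != 0 -> A y = a *: y -> B y = b *: y -> False.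
  move=> Gy /[dup] y0 /eqP + Ay By; apply; apply: (orthogonal_self hdot _ Gy).
  by split; split=> //; [exists a|exists b].
have MG0 y : M y -> G y -> y = 0.
  move=> My Gy; apply: contrapT => /eqP y0.
  have cMG := closed_subspaceI cM cG.
  have BMG z : (M `&` G) z -> (M `&` G) (B z).
    by move=> [_ Gz]; split; [exact: BM|exact: BG].
  have [|b [z [[Mz Gz] z0 Bz]]] := normal_invariant_eigenvector hdot cMG bB bSB adjB BSB BMG
    (polynomially_compact_onT _ bB pcB).
    by exists y.
  pose E := (M `&` G) `&` [set v | B v = b *: v].
  have cE : closed_subspace E by apply: closed_subspaceI => //; exact: closed_subspace_eigenspace.
  have AE v : E v -> E (A v).
    move=> [[Mv Gv] /= Bv]; split; first by split; [exact: AM|exact: AG].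
    by rewrite /= -AB// Bv (blZ bA).
  have [|a [v [[[Mv Gv] Bv] v0 Av]]] := normal_invariant_eigenvector hdot cE bA bSA adjA ASA AE
    (polynomially_compact_onT _ bA pcA).
    by exists z.
  exact: (noG a b v).
have [|a [v [Gv v0 Av]]] := normal_invariant_eigenvector hdot cG bA bSA adjA ASA AG
  (polynomially_compact_onT _ bA pcA).
  by exists x.
apply: (noG a 0 v) => //; rewrite scale0r; apply: MG0; [exact: BM|exact: BG].
Qed.

End Diagonalization.

(** * Triangularization and diagonalization of the pair *)

Theorem theorem4p5 (R : realType) (H : completeNormedModType R[i])
    (dot : {dot H for Num.conj}) (hdot : hilbert_inner_product dot)
    (A B : {linear H -> H})
    (bA : bounded_operator A) (bB : bounded_operator B)
    (pcA : polynomially_compact A) (pcB : polynomially_compact B)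
    (nB : normal_operator dot B)
    (hAB : commutator A B \o B =1 \0) :
  simultaneously_triangularizable A B /\
  (commutator A B \o commutator A B =1 \0) /\
  (normal_operator dot A ->
     simultaneously_diagonalizable A B /\
     A \o B =1 B \o A).
Proof.
have {}bA := bounded_operatorP bA; have {}bB := bounded_operatorP bB.
have [S [/bounded_operatorP bS adj BS]] := nB.
have ABB x : A (B (B x)) = B (A (B x)).
  by apply/eqP; rewrite -subr_eq0; apply/eqP; exact: (hAB x).
pose M := range_closure dot S.
have cM : closed_subspace M by exact: closed_subspace_range_closure.
have BM x : M (B x) by exact: range_closure_image.
have MA x : M x -> M (A x) by move=> /(range_closure_invariant_commute hdot bA bB adj BS ABB)[].
have AB x : M x -> A (B x) = B (A x).
  by move=> /(range_closure_invariant_commute hdot bA bB adj BS ABB)[].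
split; first exact: (triangularizable_of_flag hdot bA bB pcA pcB cM MA BM AB).
split=> [x|[SA [/bounded_operatorP bSA adjA ASA]]].
  apply/eqP; rewrite /= subr_eq0; apply/eqP/AB.
  by apply: (subspaceB (closed_subspace_sub cM)); [exact: (MA _ (BM x))|exact: BM].
have diag : simultaneously_diagonalizable A B.
  exact: (normal_pair_diagonalizable hdot bA bSA adjA ASA pcA bB bS adj BS pcB cM MA BM AB).
by split=> // x; exact: (simultaneously_diagonalizable_commute bA bB diag).
Qed.
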